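(* Let $\mathcal H$ be a Heyting category, let $A$ be an order partial combinatory algebra in $\mathcal H$ and let $\phi$ be a combinatory complete external filter of $A$. The realizability fibration $\mathsf DA/\phi$ together with the vertical filter $\mathring A$ is a pseudoinitial object of the $(2,1)$-category of fibred models for $(A,\phi)$; that is, it is a fibred model and for every fibred model $(F,C)$ there is an up to isomorphism unique morphism of fibred models $(\mathsf DA/\phi,\mathring A)\to(F,C)$.
   Context: All categories are small. A Heyting category is a regular category in which every $\mathrm{Sub}(X)$ has finite joins and every $f^{-1}$ between subobject posets has a right adjoint. Set-builder notation refers to its internal language. Fibred locales. For $F:\mathcal F\to\mathcal B$, an arrow is prone if it is Cartesian, supine if it is coCartesian, vertical if sent to an identity. $F_X$ is the fibre over $X$, $F_f$ reindexing, $\exists_f\dashv F_f$ coindexing. A fibred locale is a faithful bifibration (fibres are preorders) over a category with finite limits, with fibrewise finite products preserved by reindexing, satisfying the Beck-Chevalley condition for pullback squares and the Frobenius condition $\exists_f(X\wedge F_fY)\simeq\exists_fX\wedge Y$. It is separated if $\exists_e(\top)\simeq\top$ for each regular epimorphism $e$ of the base. A vertical morphism of fibred locales over $\mathcal H$ is a functor between total categories commuting with the projections to $\mathcal H$ that preserves prone and supine arrows and fibrewise finite products. Order partial applicative structure: an object $A$ with a preorder $\le$ and a partial binary operator $(x,y)\mapsto xy$ with domain $D\subseteq A^2$ ($xy\downarrow$ means $(x,y)\in D$) such that $x\le x'$, $y\le y'$, $x'y'\downarrow$ imply $xy\downarrow$, $xy\le x'y'$. Partial combinatory functions are the least class of partial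 functions $A^n\rightharpoonup A$ (all arities) containing projections and closed under pointwise application. For $f:A^{n+1}\rightharpoonup A$, $[\![f]\!]=\{r\in A\mid\forall\vec x\in A^n.\,r\vec x\downarrow,\ \forall\vec y\in\mathrm{dom}f.\ r\vec y\downarrow\wedge r\vec y\le f(\vec y)\}$. A filter of $A$ is a subobject closed under application and upward closed; it is combinatory complete if it meets each $[\![f]\!]$, $f$ partial combinatory, in an inhabited subobject. An order partial combinatory algebra is an order partial applicative structure with a combinatory complete filter. $\mathbf DA$ is the set of downward closed subobjects of $A$; $UV\downarrow$ iff $U\times V\subseteq D$, and then $UV=\{z\mid\exists x\in U,y\in V.\,z\le xy\}$. An external filter is $\phi\subseteq\mathbf DA$ upward closed under $\subseteq$ and closed under defined application; it is combinatory complete if $[\![f]\!]\in\phi$ for all partial combinatory $f$. Realizability fibration $\mathsf DA/\phi$ over $\mathcal H$: objects over $X$ are $Y\subseteq A\times X$ downward closed in the $A$-coordinate; a morphism $(X,Y)\to(X',Y')$ is $f:X\to X'$ such that for some $U\in\phi$, for all $u\in U$, $(a,x)\in Y$, $ua\downarrow$ and $(ua,f(x))\in Y'$. $\mathring A\in(\mathsf DA/\phi)_A$ is $\{(a,b)\mid a\le b\}$. A vertical filter is $C\in F_A$ with $F_s(C)\le F_t(C)$ for the projections $s(x,y)=x$, $t(x,y)=y$ from $\{(x,y):x\le y\}$ to $A$, and $F_p(C)\wedge F_q(C)\le F_a(C)$ for $p,q,a:D\to A$, $p(x,y)=x$, $q(x,y)=y$, $a(x,y)=xy$. A fibred model for $(A,\phi)$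 is a separated fibred locale $F:\mathcal F\to\mathcal H$ with a vertical filter $C\in F_A$ such that $F_{U\hookrightarrow A}(C)\to1$ is supine for all $U\in\phi$. A morphism $(F,C)\to(G,D)$ is a vertical morphism of fibred locales $H$ with a vertical isomorphism $h:HC\to D$. A 2-morphism $(H,h)\to(K,k)$ is an invertible 2-morphism of fibred categories $\eta:H\to K$ with $k\circ\eta_C=h$. An object $I$ of a 2-category is pseudoinitial if there is an up to isomorphism unique 1-morphism from $I$ to every object. *)

(* Defs.v *)
From Stdlib Require Import ProofIrrelevance Setoid.

Set Implicit Arguments.
Unset Strict Implicit.
Unset Printing Implicit Defensive.

(* All categories are small relative to one fixed universe; arrows are compared
   by Leibniz equality. *)
Record Category := {
  Ob :> Type;
  Hom : Ob -> Ob -> Type;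
  idm : forall X, Hom X X;
  comp : forall X Y Z, Hom Y Z -> Hom X Y -> Hom X Z;
  comp_idl : forall X Y (f : Hom X Y), comp (idm Y) f = f;
  comp_idr : forall X Y (f : Hom X Y), comp f (idm X) = f;
  comp_assoc : forall X Y Z W (h : Hom Z W) (g : Hom Y Z) (f : Hom X Y),
    comp h (comp g f) = comp (comp h g) f
}.

Arguments Hom {_} _ _.
Arguments idm {_} X.
Arguments comp {_ X Y Z} _ _.
Notation "g ∘ f" := (comp g f) (at level 40, left associativity).

Definition is_mono (C : Category) (X Y : C) (m : Hom X Y) : Prop :=
  forall T (x y : Hom T X), m ∘ x = m ∘ y -> x = y.

Definition is_iso (C : Category) (X Y : C) (f : Hom X Y) : Prop :=
  exists g : Hom Y X, g ∘ f = idm X /\ f ∘ g = idm Y.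

Definition is_terminal (C : Category) (T : C) : Prop :=
  forall X : C, exists! f : Hom X T, True.

Definition is_pullback (C : Category) (W X Y Z : C)
    (a : Hom W X) (b : Hom W Y) (f : Hom X Z) (g : Hom Y Z) : Prop :=
  f ∘ a = g ∘ b /\
  forall T (x : Hom T X) (y : Hom T Y), f ∘ x = g ∘ y ->
    exists! t : Hom T W, a ∘ t = x /\ b ∘ t = y.

Definition is_regular_epi (C : Category) (X Y : C) (e : Hom X Y) : Prop :=
  exists (W : C) (u v : Hom W X), e ∘ u = e ∘ v /\
    forall Z (g : Hom X Z), g ∘ u = g ∘ v -> exists! h : Hom Y Z, h ∘ e = g.

Record Functor (C D : Category) := {
  fob :> C -> D;
  fmap : forall X Y, Hom X Y -> Hom (fob X) (fob Y);
  fmap_id : forall X, fmap (idm X) = idm (fob X);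
  fmap_comp : forall X Y Z (g : Hom Y Z) (f : Hom X Y),
    fmap (g ∘ f) = fmap g ∘ fmap f
}.

Arguments fmap {_ _} _ {_ _} _.

(* Equality of arrows whose end points are only propositionally equal. *)
Inductive arr_eq (C : Category) (X Y : C) (f : Hom X Y) :
    forall X' Y' : C, Hom X' Y' -> Prop :=
  arr_eq_refl : arr_eq f f.

Record Sub (C : Category) (X : C) := {
  sdom : C;
  sarr : Hom sdom X;
  smono : is_mono sarr
}.

Arguments sdom {_ _} _.
Arguments sarr {_ _} _.
Arguments smono {_ _} _.

(* [x ∈ S] for a generalized element [x : T -> X].  Horn sequents of the
   internal language are written on generalized elements below; nested
   quantifiers are interpreted by the adjoints of reindexing. *)
Definition mem (C : Category) (T X : C) (x : Hom T X) (S : Sub X) : Prop :=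
  exists t : Hom T (sdom S), sarr S ∘ t = x.
Notation "x ∈ S" := (mem x S) (at level 70).

Definition sub_le (C : Category) (X : C) (S S' : Sub X) : Prop := sarr S ∈ S'.
Notation "S ⊑ S'" := (sub_le S S') (at level 70).

(* Finite limits, images and the operations on subobjects are chosen. *)
Record FinLim := {
  fl_cat :> Category;
  one : fl_cat;
  bang : forall X : fl_cat, Hom X one;
  bang_uniq : forall (X : fl_cat) (f : Hom X one), f = bang X;
  prd : fl_cat -> fl_cat -> fl_cat;
  pr1 : forall X Y, Hom (prd X Y) X;
  pr2 : forall X Y, Hom (prd X Y) Y;
  pair : forall T X Y, Hom T X -> Hom T Y -> Hom T (prd X Y);
  pr1_pair : forall T X Y (x : Hom T X) (y : Hom T Y), pr1 X Y ∘ pair x y = x;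
  pr2_pair : forall T X Y (x : Hom T X) (y : Hom T Y), pr2 X Y ∘ pair x y = y;
  pair_eta : forall T X Y (z : Hom T (prd X Y)),
    pair (pr1 X Y ∘ z) (pr2 X Y ∘ z) = z;
  pbk : forall X Y Z : fl_cat, Hom X Z -> Hom Y Z -> fl_cat;
  pbk1 : forall X Y Z (f : Hom X Z) (g : Hom Y Z), Hom (pbk f g) X;
  pbk2 : forall X Y Z (f : Hom X Z) (g : Hom Y Z), Hom (pbk f g) Y;
  pbkP : forall X Y Z (f : Hom X Z) (g : Hom Y Z),
    is_pullback (pbk1 f g) (pbk2 f g) f g
}.

Arguments one {_}.
Arguments bang {_} X.
Arguments prd {_} _ _.
Arguments pr1 {_ X Y}.
Arguments pr2 {_ X Y}.
Arguments pair {_ T X Y} _ _.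
Arguments pbk {_ X Y Z} _ _.
Arguments pbk1 {_ X Y Z} _ _.
Arguments pbk2 {_ X Y Z} _ _.
Notation "⟨ x , y ⟩" := (pair x y).

Lemma comp_mono (C : Category) (X Y Z : C) (m : Hom Y Z) (n : Hom X Y) :
  is_mono m -> is_mono n -> is_mono (m ∘ n).
Proof.
intros Hm Hn T x y E; apply Hn, Hm.
now rewrite !comp_assoc.
Qed.

Lemma pbk2_mono (C : FinLim) (X Y Z : C) (m : Hom X Z) (f : Hom Y Z) :
  is_mono m -> is_mono (pbk2 m f).
Proof.
intros Hm T x y E; destruct (pbkP m f) as [E0 U].
assert (E1 : pbk1 m f ∘ x = pbk1 m f ∘ y).
{ apply Hm; rewrite !comp_assoc, !E0, <- !comp_assoc; congruence. }
destruct (U T (pbk1 m f ∘ y) (pbk2 m f ∘ y)) as [t [_ Ht]].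
{ now rewrite !comp_assoc, E0. }
rewrite <- (Ht x (conj E1 E)); apply Ht; now split.
Qed.

Definition sub_full (C : Category) (X : C) : Sub X.
Proof.
refine {| sdom := X; sarr := idm X; smono := _ |}.
abstract (intros T x y; now rewrite !comp_idl).
Defined.

Definition sub_comp (C : Category) (X : C) (S : Sub X) (S' : Sub (sdom S)) : Sub X :=
  {| sdom := sdom S'; sarr := sarr S ∘ sarr S';
     smono := comp_mono (smono S) (smono S') |}.

Definition sub_pb (C : FinLim) (X Y : C) (f : Hom X Y) (S : Sub Y) : Sub X :=
  {| sdom := pbk (sarr S) f; sarr := pbk2 (sarr S) f;
     smono := pbk2_mono (smono S) |}.

Definition sub_meet (C : FinLim) (X : C) (S S' : Sub X) : Sub X :=
  {| sdom := pbk (sarr S) (sarr S'); sarr := sarr S' ∘ pbk2 (sarr S) (sarr S');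
     smono := comp_mono (smono S') (pbk2_mono (smono S)) |}.

Record RegularCategory := {
  reg_fl :> FinLim;
  im : forall (X Y : reg_fl), Hom X Y -> Sub Y;
  im_e : forall X Y (f : Hom X Y), Hom X (sdom (im f));
  im_fact : forall X Y (f : Hom X Y), sarr (im f) ∘ im_e f = f;
  im_epi : forall X Y (f : Hom X Y), is_regular_epi (im_e f);
  reg_stable : forall (W X Y Z : reg_fl) (a : Hom W X) (b : Hom W Y)
    (e : Hom X Z) (g : Hom Y Z),
    is_pullback a b e g -> is_regular_epi e -> is_regular_epi b
}.

Arguments im {_ X Y} _.
Arguments im_e {_ X Y} _.

Record HeytingCategory := {
  hey_reg :> RegularCategory;
  sub_bot : forall X : hey_reg, Sub X;
  sub_botP : forall (X : hey_reg) (S : Sub X), sub_bot X ⊑ S;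
  sub_join : forall X : hey_reg, Sub X -> Sub X -> Sub X;
  sub_joinP : forall (X : hey_reg) (S S' R : Sub X),
    sub_join S S' ⊑ R <-> S ⊑ R /\ S' ⊑ R;
  sub_all : forall X Y : hey_reg, Hom X Y -> Sub X -> Sub Y;
  sub_allP : forall (X Y : hey_reg) (f : Hom X Y) (S : Sub X) (R : Sub Y),
    sub_pb f R ⊑ S <-> R ⊑ sub_all f S
}.

Arguments sub_all {_ X Y} _ _.

Definition sub_ex (C : RegularCategory) (X Y : C) (f : Hom X Y) (S : Sub X) : Sub Y :=
  im (f ∘ sarr S).

(* The sequent [⊢ exists x, x ∈ S]. *)
Definition inhabited_sub (C : FinLim) (X : C) (S : Sub X) : Prop :=
  is_regular_epi (bang (sdom S)).

Record PFun (C : Category) (X Y : C) := {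
  pdom : Sub X;
  pval : Hom (sdom pdom) Y
}.

Arguments pdom {_ X Y} _.
Arguments pval {_ X Y} _.

(* [f x ⇓ y]: the partial function [f] is defined at [x], with value [y]. *)
Definition pf_at (C : Category) (T X Y : C) (f : PFun X Y) (x : Hom T X) (y : Hom T Y) : Prop :=
  exists t, sarr (pdom f) ∘ t = x /\ pval f ∘ t = y.

Definition pf_eq (C : Category) (X Y : C) (f g : PFun X Y) : Prop :=
  forall T (x : Hom T X) (y : Hom T Y), pf_at f x y <-> pf_at g x y.

Definition pf_total (C : Category) (X Y : C) (f : Hom X Y) : PFun X Y :=
  {| pdom := sub_full X; pval := f |}.

Definition pf_comp (C : FinLim) (X Y Z : C) (g : PFun Y Z) (f : PFun X Y) : PFun X Z :=
  {| pdom := sub_comp (sub_pb (pval f) (pdom g));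
     pval := pval g ∘ pbk1 (sarr (pdom g)) (pval f) |}.

Definition pf_pair (C : FinLim) (X Y Z : C) (f : PFun X Y) (g : PFun X Z) :
    PFun X (prd Y Z) :=
  {| pdom := sub_meet (pdom f) (pdom g);
     pval := ⟨ pval f ∘ pbk1 (sarr (pdom f)) (sarr (pdom g)),
               pval g ∘ pbk2 (sarr (pdom f)) (sarr (pdom g)) ⟩ |}.

(* {x | f(x)↓ and R(f(x))} *)
Definition pf_holds (C : FinLim) (X Y : C) (R : Sub Y) (f : PFun X Y) : Sub X :=
  sub_comp (sub_pb (pval f) R).

Record OPAS (H : FinLim) := {
  car :> H;
  leq : Sub (prd car car);
  leq_refl : forall T (x : Hom T car), ⟨x, x⟩ ∈ leq;
  leq_trans : forall T (x y z : Hom T car),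
    ⟨x, y⟩ ∈ leq -> ⟨y, z⟩ ∈ leq -> ⟨x, z⟩ ∈ leq;
  app : PFun (prd car car) car;
  app_mono : forall T (x x' y y' v' : Hom T car),
    ⟨x, x'⟩ ∈ leq -> ⟨y, y'⟩ ∈ leq -> pf_at app ⟨x', y'⟩ v' ->
    exists v, pf_at app ⟨x, y⟩ v /\ ⟨v, v'⟩ ∈ leq
}.

Arguments leq {_} _.
Arguments app {_} _.
Arguments leq_refl {_ _ T} x.

Definition papp (H : FinLim) (A : OPAS H) (G : H) (t s : PFun G A) : PFun G A :=
  pf_comp (app A) (pf_pair t s).

Fixpoint pow (H : FinLim) (A : H) (n : nat) : H :=
  match n with
  | O => one
  | S m => prd (pow A m) A
  end.

Inductive is_proj (H : FinLim) (A : H) : forall n, Hom (pow A n) A -> Prop :=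
| proj_last : forall n, @is_proj H A (S n) pr2
| proj_weak : forall n (p : Hom (pow A n) A),
    is_proj p -> @is_proj H A (S n) (p ∘ pr1).

(* A partial function is a span with monic left leg, up to isomorphism of spans;
   hence [pcomb_eq]. *)
Inductive pcomb (H : FinLim) (A : OPAS H) : forall n, PFun (pow A n) A -> Prop :=
| pcomb_proj : forall n (p : Hom (pow A n) A), is_proj p -> pcomb (pf_total p)
| pcomb_app : forall n (f g : PFun (pow A n) A),
    pcomb f -> pcomb g -> pcomb (papp f g)
| pcomb_eq : forall n (f g : PFun (pow A n) A), pf_eq f g -> pcomb f -> pcomb g.

(* (r, (x_1, ..., x_n)) |-> (...(r x_1)...) x_n *)
Fixpoint iter_app (H : FinLim) (A : OPAS H) (n : nat) : PFun (prd A (pow A n)) A :=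
  match n return PFun (prd A (pow A n)) A with
  | O => pf_total pr1
  | S m => papp (pf_comp (iter_app A m) (pf_total ⟨pr1, pr1 ∘ pr2⟩))
                (pf_total (pr2 ∘ pr2))
  end.

(* {r | (for all x in A^n, r x↓) and (for all y in dom f, r y↓ and r y <= f(y))},
   for [f] of arity [n + 1]; [pf_holds] includes definedness. *)
Definition realizers (H : HeytingCategory) (A : OPAS H) (n : nat)
    (f : PFun (pow A (S n)) A) : Sub A :=
  sub_meet
    (sub_all (pr1 : Hom (prd A (pow A n)) A) (pdom (iter_app A n)))
    (sub_all (pr1 : Hom (prd A (sdom (pdom f))) A)
       (pf_holds (leq A)
          (pf_pair
             (pf_comp (iter_app A (S n)) (pf_total ⟨pr1, sarr (pdom f) ∘ pr2⟩))
             (pf_total (pval f ∘ pr2))))).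

Definition is_filter (H : FinLim) (A : OPAS H) (P : Sub A) : Prop :=
  (forall T (x y v : Hom T A), x ∈ P -> y ∈ P -> pf_at (app A) ⟨x, y⟩ v -> v ∈ P) /\
  (forall T (x y : Hom T A), x ∈ P -> ⟨x, y⟩ ∈ leq A -> y ∈ P).

Definition filter_complete (H : HeytingCategory) (A : OPAS H) (P : Sub A) : Prop :=
  forall n (f : PFun (pow A (S n)) A), pcomb f ->
    inhabited_sub (sub_meet P (realizers f)).

Record OPCA (H : HeytingCategory) := {
  opca_opas :> OPAS H;
  opca_filter : Sub opca_opas;
  opca_filterP : is_filter opca_filter;
  opca_complete : filter_complete opca_filter
}.

Definition down_closed (H : FinLim) (A : OPAS H) (U : Sub A) : Prop :=
  forall T (x y : Hom T A), ⟨x, y⟩ ∈ leq A -> y ∈ U -> x ∈ U.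

(* [U × V ⊆ D], that is, [UV↓]; [sub_app U V] is only used under this condition. *)
Definition sub_app_def (H : FinLim) (A : OPAS H) (U V : Sub A) : Prop :=
  sub_meet (sub_pb pr1 U) (sub_pb pr2 V) ⊑ pdom (app A).

(* {z | exists x in U and y in V such that z <= xy}, in the context z, (x, y) *)
Definition sub_app (H : RegularCategory) (A : OPAS H) (U V : Sub A) : Sub A :=
  sub_ex (pr1 : Hom (prd A (prd A A)) A)
    (sub_meet (sub_meet (sub_pb (pr1 ∘ pr2) U) (sub_pb (pr2 ∘ pr2) V))
       (pf_holds (leq A) (pf_pair (pf_total pr1) (pf_comp (app A) (pf_total pr2))))).

Record ExternalFilter (H : RegularCategory) (A : OPAS H) := {
  ef_mem :> Sub A -> Prop;
  ef_down : forall U, ef_mem U -> down_closed U;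
  ef_up : forall U V, ef_mem U -> down_closed V -> U ⊑ V -> ef_mem V;
  ef_app : forall U V, ef_mem U -> ef_mem V -> sub_app_def U V ->
    ef_mem (sub_app U V)
}.

Definition ext_complete (H : HeytingCategory) (A : OPAS H) (phi : ExternalFilter A) : Prop :=
  forall n (f : PFun (pow A (S n)) A), pcomb f -> phi (realizers f).

Section Elements.
Context (H : HeytingCategory).

Lemma comp_pair (T' T X Y : H) (x : Hom T X) (y : Hom T Y) (t : Hom T' T) :
  ⟨x, y⟩ ∘ t = ⟨x ∘ t, y ∘ t⟩.
Proof.
rewrite <- (pair_eta (⟨x, y⟩ ∘ t)), !comp_assoc, pr1_pair, pr2_pair.
reflexivity.
Qed.

Lemma mem_comp (T' T X : H) (x : Hom T X) (S : Sub X) (t : Hom T' T) :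
  x ∈ S -> (x ∘ t) ∈ S.
Proof. intros [s E]; exists (s ∘ t); now rewrite comp_assoc, E. Qed.

Lemma sub_le_mem (X T : H) (S S' : Sub X) (x : Hom T X) : S ⊑ S' -> x ∈ S -> x ∈ S'.
Proof. intros L [s <-]; now apply mem_comp. Qed.

Lemma sub_leI (X : H) (S S' : Sub X) :
  (forall (T : H) (x : Hom T X), x ∈ S -> x ∈ S') -> S ⊑ S'.
Proof. intros K; apply K; exists (idm _); apply comp_idr. Qed.

Lemma mem_pb (X Y T : H) (f : Hom X Y) (S : Sub Y) (x : Hom T X) :
  x ∈ sub_pb f S <-> (f ∘ x) ∈ S.
Proof.
split.
- intros [t <-]; cbn; exists (pbk1 (sarr S) f ∘ t).
  now rewrite !comp_assoc, (proj1 (pbkP (sarr S) f)).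
- intros [s E]; destruct (proj2 (pbkP (sarr S) f) T s x E) as [t [[_ E2] _]].
  now exists t.
Qed.

Lemma mem_meet (X T : H) (S S' : Sub X) (x : Hom T X) :
  x ∈ sub_meet S S' <-> x ∈ S /\ x ∈ S'.
Proof.
split.
- intros [t <-]; cbn; split.
  + exists (pbk1 (sarr S) (sarr S') ∘ t).
    now rewrite comp_assoc, (proj1 (pbkP (sarr S) (sarr S'))).
  + exists (pbk2 (sarr S) (sarr S') ∘ t); now rewrite comp_assoc.
- intros [[s E] [s' <-]].
  destruct (proj2 (pbkP (sarr S) (sarr S')) T s s' E) as [t [[_ E2] _]].
  exists t; cbn; now rewrite <- comp_assoc, E2.
Qed.

Lemma mem_full (X T : H) (x : Hom T X) : x ∈ sub_full X.
Proof. exists x; apply comp_idl. Qed.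

Lemma mem_all (X Y T : H) (f : Hom X Y) (S : Sub X) (x : Hom T X) :
  (f ∘ x) ∈ sub_all f S -> x ∈ S.
Proof.
intros M; apply (@sub_le_mem _ _ (sub_pb f (sub_all f S))); [|now apply mem_pb].
apply sub_allP; exists (idm _); apply comp_idr.
Qed.

Lemma regular_epi_epi (X Y Z : H) (e : Hom X Y) (g h : Hom Y Z) :
  is_regular_epi e -> g ∘ e = h ∘ e -> g = h.
Proof.
intros [W [u [v [E U]]]] Egh.
destruct (U Z (h ∘ e)) as [k [_ Hk]].
{ now rewrite <- !comp_assoc, E. }
rewrite <- (Hk g Egh); now apply Hk.
Qed.

Lemma mem_local (X T T' : H) (e : Hom T' T) (x : Hom T X) (S : Sub X) :
  is_regular_epi e -> (x ∘ e) ∈ S -> x ∈ S.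
Proof.
intros He [w Ew]; pose proof He as [W [u [v [E U]]]].
destruct (U _ w) as [w' [Ew' _]].
{ apply (smono (S)); now rewrite !comp_assoc, Ew, <- !comp_assoc, E. }
exists w'; apply (regular_epi_epi He); now rewrite <- comp_assoc, Ew'.
Qed.

Lemma mem_ex (X Y T : H) (f : Hom X Y) (S : Sub X) (y : Hom T Y) :
  y ∈ sub_ex f S ->
  exists (T' : H) (e : Hom T' T) (x : Hom T' X),
    is_regular_epi e /\ x ∈ S /\ f ∘ x = y ∘ e.
Proof.
intros [t Et].
exists (pbk (im_e (f ∘ sarr S)) t), (pbk2 _ _), (sarr S ∘ pbk1 _ _).
split; [|split].
- exact (reg_stable (pbkP _ _) (im_epi _)).
- now exists (pbk1 (im_e (f ∘ sarr S)) t).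
- unfold sub_ex in Et; rewrite <- Et, <- comp_assoc, <- (proj1 (pbkP _ _)), !comp_assoc.
  now rewrite im_fact.
Qed.

Lemma pf_at_mem (X Y T : H) (f : PFun X Y) (x : Hom T X) :
  x ∈ pdom f <-> exists y, pf_at f x y.
Proof.
split.
- intros [t E]; exists (pval f ∘ t); now exists t.
- intros [y [t [E _]]]; now exists t.
Qed.

Lemma pf_at_fun (X Y T : H) (f : PFun X Y) (x : Hom T X) (y y' : Hom T Y) :
  pf_at f x y -> pf_at f x y' -> y = y'.
Proof.
intros [t [E1 <-]] [t' [E2 <-]]; f_equal; apply (smono (pdom f)); congruence.
Qed.

Lemma pf_at_comp (X Y T T' : H) (f : PFun X Y) (x : Hom T X) (y : Hom T Y) (t : Hom T' T) :
  pf_at f x y -> pf_at f (x ∘ t) (y ∘ t).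
Proof. intros [s [<- <-]]; exists (s ∘ t); now rewrite !comp_assoc. Qed.

Lemma pf_at_total (X Y T : H) (f : Hom X Y) (x : Hom T X) (y : Hom T Y) :
  pf_at (pf_total f) x y <-> f ∘ x = y.
Proof.
split.
- intros [t [<- <-]]; cbn; now rewrite comp_idl.
- intros <-; exists x; cbn; now rewrite comp_idl.
Qed.

Lemma pf_at_pcomp (X Y Z T : H) (g : PFun Y Z) (f : PFun X Y) (x : Hom T X) (z : Hom T Z) :
  pf_at (pf_comp g f) x z <-> exists y, pf_at f x y /\ pf_at g y z.
Proof.
split.
- intros [t [<- <-]]; cbn in *.
  exists (pval f ∘ (pbk2 (sarr (pdom g)) (pval f) ∘ t)); split.
  + exists (pbk2 (sarr (pdom g)) (pval f) ∘ t); now rewrite comp_assoc.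
  + exists (pbk1 (sarr (pdom g)) (pval f) ∘ t).
    now rewrite !comp_assoc, (proj1 (pbkP (sarr (pdom g)) (pval f))).
- intros [y [[s [<- <-]] [s' [E <-]]]].
  destruct (proj2 (pbkP (sarr (pdom g)) (pval f)) T s' s E) as [t [[E1 E2] _]].
  exists t; cbn; now rewrite <- !comp_assoc, E1, E2.
Qed.

Lemma pf_at_ppair (X Y Z T : H) (f : PFun X Y) (g : PFun X Z) (x : Hom T X)
    (y : Hom T Y) (z : Hom T Z) :
  pf_at (pf_pair f g) x ⟨y, z⟩ <-> pf_at f x y /\ pf_at g x z.
Proof.
pose proof (pbkP (sarr (pdom f)) (sarr (pdom g))) as [E0 U].
split.
- intros [t [<- E]]; cbn in *; rewrite comp_pair in E.
  assert (Ey : y = pval f ∘ pbk1 (sarr (pdom f)) (sarr (pdom g)) ∘ t).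
  { now rewrite <- (pr1_pair y z), <- E, pr1_pair. }
  assert (Ez : z = pval g ∘ pbk2 (sarr (pdom f)) (sarr (pdom g)) ∘ t).
  { now rewrite <- (pr2_pair y z), <- E, pr2_pair. }
  subst y z; split.
  + exists (pbk1 (sarr (pdom f)) (sarr (pdom g)) ∘ t); now rewrite !comp_assoc, E0.
  + exists (pbk2 (sarr (pdom f)) (sarr (pdom g)) ∘ t); now rewrite !comp_assoc.
- intros [[s [E <-]] [s' [<- <-]]].
  destruct (U T s s' E) as [t [[E1 E2] _]].
  exists t; cbn; now rewrite comp_pair, <- !comp_assoc, E1, E2.
Qed.

Lemma mem_holds (X Y T : H) (R : Sub Y) (f : PFun X Y) (x : Hom T X) :
  x ∈ pf_holds R f <-> exists y, pf_at f x y /\ y ∈ R.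
Proof.
split.
- intros [t <-]; cbn.
  exists (pval f ∘ (pbk2 (sarr R) (pval f) ∘ t)); split.
  + exists (pbk2 (sarr R) (pval f) ∘ t); now rewrite comp_assoc.
  + exists (pbk1 (sarr R) (pval f) ∘ t).
    now rewrite !comp_assoc, (proj1 (pbkP (sarr R) (pval f))).
- intros [y [[s [<- <-]] [s' E]]].
  destruct (proj2 (pbkP (sarr R) (pval f)) T s' s E) as [t [[E1 E2] _]].
  exists t; cbn; now rewrite <- !comp_assoc, E2.
Qed.

Lemma pf_at_local (X Y T T' : H) (e : Hom T' T) (f : PFun X Y) (x : Hom T X)
    (w : Hom T' Y) :
  is_regular_epi e -> pf_at f (x ∘ e) w -> exists y, pf_at f x y /\ y ∘ e = w.
Proof.
intros He F.
assert (M : x ∈ pdom f).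
{ apply (mem_local He); apply pf_at_mem; now exists w. }
apply pf_at_mem in M; destruct M as [y Fy]; exists y; split; [exact Fy|].
exact (pf_at_fun (pf_at_comp e Fy) F).
Qed.

Context (A : OPAS H).

Lemma pf_at_papp (G T : H) (t s : PFun G A) (g : Hom T G) (v : Hom T A) :
  pf_at (papp t s) g v <->
  exists a b, pf_at t g a /\ pf_at s g b /\ pf_at (app A) ⟨a, b⟩ v.
Proof.
unfold papp; rewrite pf_at_pcomp; split.
- intros [y [P Q]]; rewrite <- (pair_eta y) in P, Q.
  apply pf_at_ppair in P; exists (pr1 ∘ y), (pr2 ∘ y); tauto.
- intros [a [b [P [Q R]]]]; exists ⟨a, b⟩; split; [now apply pf_at_ppair|exact R].
Qed.

Lemma iter_appO (T : H) (r v : Hom T A) (x : Hom T (pow A 0)) :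
  pf_at (iter_app A 0) ⟨r, x⟩ v <-> r = v.
Proof. cbn; now rewrite pf_at_total, pr1_pair. Qed.

Lemma iter_appS (n : nat) (T : H) (r x v : Hom T A) (xs : Hom T (pow A n)) :
  pf_at (iter_app A (S n)) ⟨r, ⟨xs, x⟩⟩ v <->
  exists p, pf_at (iter_app A n) ⟨r, xs⟩ p /\ pf_at (app A) ⟨p, x⟩ v.
Proof.
cbn [iter_app pow]; rewrite pf_at_papp.
assert (E1 : ⟨pr1, pr1 ∘ pr2⟩ ∘ ⟨r, ⟨xs, x⟩⟩ = ⟨r, xs⟩).
{ now rewrite comp_pair, <- comp_assoc, pr1_pair, pr2_pair, pr1_pair. }
assert (E2 : pr2 ∘ pr2 ∘ ⟨r, ⟨xs, x⟩⟩ = x).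
{ now rewrite <- comp_assoc, !pr2_pair. }
split.
- intros [a [b [P [Q R]]]].
  apply pf_at_pcomp in P; destruct P as [y [P1 P2]].
  apply pf_at_total in P1; rewrite E1 in P1; subst y.
  apply pf_at_total in Q; rewrite E2 in Q; subst b.
  now exists a.
- intros [p [P Q]]; exists p, x; split; [|split].
  + apply pf_at_pcomp; exists ⟨r, xs⟩; split; [|exact P].
    now apply pf_at_total.
  + now apply pf_at_total.
  + exact Q.
Qed.

Lemma realizers_dom (n : nat) (f : PFun (pow A (S n)) A) (T : H) (r : Hom T A)
    (xs : Hom T (pow A n)) :
  r ∈ realizers f -> exists v, pf_at (iter_app A n) ⟨r, xs⟩ v.
Proof.
intros M; apply mem_meet in M; destruct M as [M _].
apply pf_at_mem; apply (mem_all (f := pr1)); now rewrite pr1_pair.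
Qed.

Lemma realizers_val (n : nat) (f : PFun (pow A (S n)) A) (T : H) (r v : Hom T A)
    (ys : Hom T (pow A (S n))) :
  r ∈ realizers f -> pf_at f ys v ->
  exists w, pf_at (iter_app A (S n)) ⟨r, ys⟩ w /\ ⟨w, v⟩ ∈ leq A.
Proof.
intros M [t [<- <-]]; apply mem_meet in M; destruct M as [_ M].
rewrite <- (pr1_pair r t) in M; apply mem_all, mem_holds in M.
destruct M as [y [P L]]; rewrite <- (pair_eta y) in P, L.
apply pf_at_ppair in P; destruct P as [P Q].
apply pf_at_total in Q; rewrite <- comp_assoc, pr2_pair in Q.
rewrite <- Q in L.
apply pf_at_pcomp in P; destruct P as [z [P1 P2]].
apply pf_at_total in P1; rewrite comp_pair, <- comp_assoc, pr1_pair, pr2_pair in P1.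
subst z; now exists (pr1 ∘ y).
Qed.

Lemma mem_sub_app (U V : Sub A) (T : H) (z : Hom T A) :
  z ∈ sub_app U V ->
  exists (T' : H) (e : Hom T' T) (x y v : Hom T' A),
    is_regular_epi e /\ x ∈ U /\ y ∈ V /\ pf_at (app A) ⟨x, y⟩ v /\
    ⟨z ∘ e, v⟩ ∈ leq A.
Proof.
intros M; apply mem_ex in M; destruct M as [T' [e [c [He [M E]]]]].
apply mem_meet in M; destruct M as [M M3].
apply mem_meet in M; destruct M as [M1 M2].
apply mem_pb in M1; apply mem_pb in M2.
apply mem_holds in M3; destruct M3 as [y [P L]].
rewrite <- (pair_eta y) in P, L; apply pf_at_ppair in P; destruct P as [P Q].
apply pf_at_total in P; rewrite E in P; rewrite <- P in L.
apply pf_at_pcomp in Q; destruct Q as [q [Q1 Q2]].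
apply pf_at_total in Q1; subst q.
exists T', e, (pr1 ∘ pr2 ∘ c), (pr2 ∘ pr2 ∘ c), (pr2 ∘ y).
repeat split; try assumption.
now rewrite <- !comp_assoc, pair_eta.
Qed.

Lemma sub_app_defI (U V : Sub A) :
  (forall T (x y : Hom T A), x ∈ U -> y ∈ V -> exists v, pf_at (app A) ⟨x, y⟩ v) ->
  sub_app_def U V.
Proof.
intros K; apply sub_leI; intros T z Mz.
apply mem_meet in Mz; rewrite !mem_pb in Mz; destruct Mz as [M1 M2].
apply pf_at_mem; destruct (K _ _ _ M1 M2) as [v P]; exists v.
now rewrite pair_eta in P.
Qed.

End Elements.

Section Realizability.
Context (H : HeytingCategory) (A : OPAS H) (phi : ExternalFilter A).

(* An arrow [f] between these objects is realized by [U] when for all u in U and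
   (a, x) in the source, ua↓ and (ua, f(x)) is in the target. *)
Record DOb := {
  dbase : H;
  dpred : Sub (prd A dbase);
  ddown : forall T (a b : Hom T A) (x : Hom T dbase),
    ⟨a, b⟩ ∈ leq A -> ⟨b, x⟩ ∈ dpred -> ⟨a, x⟩ ∈ dpred
}.

Definition realized_by (P Q : DOb) (f : Hom (dbase P) (dbase Q)) (U : Sub A) : Prop :=
  forall T (u a : Hom T A) (x : Hom T (dbase P)), u ∈ U -> ⟨a, x⟩ ∈ dpred P ->
    exists v, pf_at (app A) ⟨u, a⟩ v /\ ⟨v, f ∘ x⟩ ∈ dpred Q.

Definition realizable (P Q : DOb) (f : Hom (dbase P) (dbase Q)) : Prop :=
  exists U, phi U /\ realized_by f U.

Definition DHom (P Q : DOb) : Type := {f : Hom (dbase P) (dbase Q) | realizable f}.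

Lemma DHom_eq (P Q : DOb) (f g : DHom P Q) : proj1_sig f = proj1_sig g -> f = g.
Proof.
destruct f as [f Hf], g as [g Hg]; cbn; intros <-.
now rewrite (proof_irrelevance _ Hf Hg).
Qed.

Context (phi_complete : ext_complete phi).

Lemma realizable_id (P : DOb) : realizable (P := P) (Q := P) (idm (dbase P)).
Proof.
pose (f := pf_total (pr2 : Hom (pow A 1) A)).
exists (realizers f); split.
- apply phi_complete, pcomb_proj, proj_last.
- intros T u a x Mu Ma; rewrite comp_idl.
  destruct (realizers_val (n := 0) (v := a) (ys := ⟨bang T, a⟩) Mu) as [w [Hw L]].
  { apply pf_at_total, pr2_pair. }
  apply iter_appS in Hw; destruct Hw as [p [Hp Hw]].
  apply iter_appO in Hp; subst p.
  exists w; split; [exact Hw|exact (ddown L Ma)].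
Qed.

(* (x, y, z) |-> x (y z) *)
Definition Bcomb : PFun (pow A 3) A :=
  papp (pf_total (pr2 ∘ pr1 ∘ pr1 : Hom (pow A 3) A))
    (papp (pf_total (pr2 ∘ pr1 : Hom (pow A 3) A)) (pf_total (pr2 : Hom (pow A 3) A))).

Lemma pcomb_B : pcomb Bcomb.
Proof.
apply pcomb_app; [|apply pcomb_app]; apply pcomb_proj; repeat constructor.
Qed.

Lemma realizable_comp (P Q R : DOb) (g : Hom (dbase Q) (dbase R))
    (f : Hom (dbase P) (dbase Q)) :
  realizable g -> realizable f -> realizable (P := P) (Q := R) (g ∘ f).
Proof.
intros [V [HV RV]] [U [HU RU]].
pose (B := realizers Bcomb).
assert (HB : phi B) by apply phi_complete, pcomb_B.
assert (B1 : forall T (r x : Hom T A), r ∈ B -> exists v, pf_at (app A) ⟨r, x⟩ v).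
{ intros T r x Mr.
  destruct (realizers_dom (n := 2) ⟨⟨bang T, x⟩, x⟩ Mr) as [w Hw].
  apply iter_appS in Hw; destruct Hw as [p [Hp _]].
  apply iter_appS in Hp; destruct Hp as [q [Hq Hp]].
  apply iter_appO in Hq; subst q; now exists p. }
assert (B2 : forall T (r x y p : Hom T A), r ∈ B -> pf_at (app A) ⟨r, x⟩ p ->
  exists v, pf_at (app A) ⟨p, y⟩ v).
{ intros T r x y p Mr Hrx.
  destruct (realizers_dom (n := 2) ⟨⟨bang T, x⟩, y⟩ Mr) as [w Hw].
  apply iter_appS in Hw; destruct Hw as [p' [Hp Hw]].
  apply iter_appS in Hp; destruct Hp as [q [Hq Hp]].
  apply iter_appO in Hq; subst q.
  rewrite (pf_at_fun Hrx Hp); now exists w. }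
assert (B3 : forall T (r x y z p q s t : Hom T A), r ∈ B ->
  pf_at (app A) ⟨r, x⟩ p -> pf_at (app A) ⟨p, y⟩ q ->
  pf_at (app A) ⟨y, z⟩ s -> pf_at (app A) ⟨x, s⟩ t ->
  exists v, pf_at (app A) ⟨q, z⟩ v /\ ⟨v, t⟩ ∈ leq A).
{ intros T r x y z p q s t Mr Hp Hq Hs Ht.
  destruct (realizers_val (n := 2) (v := t) (ys := ⟨⟨⟨bang T, x⟩, y⟩, z⟩) Mr) as [w [Hw L]].
  { unfold Bcomb; apply pf_at_papp; exists x, s; split; [|split; [|exact Ht]].
    - apply pf_at_total; now rewrite <- !comp_assoc, !pr1_pair, pr2_pair.
    - apply pf_at_papp; exists y, z; split; [|split; [|exact Hs]]; apply pf_at_total.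
      + now rewrite <- !comp_assoc, !pr1_pair, pr2_pair.
      + apply pr2_pair. }
  apply iter_appS in Hw; destruct Hw as [q' [Hq' Hw]].
  apply iter_appS in Hq'; destruct Hq' as [p' [Hp' Hq']].
  apply iter_appS in Hp'; destruct Hp' as [r' [Hr Hp']].
  apply iter_appO in Hr; subst r'.
  rewrite <- (pf_at_fun Hp Hp') in Hq'; rewrite <- (pf_at_fun Hq Hq') in Hw.
  now exists w. }
assert (D1 : sub_app_def B V).
{ apply sub_app_defI; intros T x y Mx _; now apply B1. }
assert (D2 : sub_app_def (sub_app B V) U).
{ apply sub_app_defI; intros T x y Mx _.
  apply mem_sub_app in Mx.
  destruct Mx as [T' [e [b [c [p [He [Mb [_ [Hp L]]]]]]]]].
  destruct (B2 _ _ _ (y ∘ e) _ Mb Hp) as [v Hv].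
  destruct (app_mono L (leq_refl _) Hv) as [v' [Hv' _]].
  rewrite <- comp_pair in Hv'.
  destruct (pf_at_local He Hv') as [w [Hw _]]; now exists w. }
exists (sub_app (sub_app B V) U); split.
{ apply ef_app; [apply ef_app| |]; assumption. }
intros T u a x Mu Ma.
apply mem_sub_app in Mu; destruct Mu as [T1 [e1 [q [c [t [He1 [Mq [Mc [Ht Lt]]]]]]]]].
apply mem_sub_app in Mq; destruct Mq as [T2 [e2 [b [d [p [He2 [Mb [Md [Hp Lp]]]]]]]]].
apply (mem_comp e2) in Mc, Lt; apply (pf_at_comp e2) in Ht.
apply (mem_comp e1), (mem_comp e2) in Ma.
rewrite comp_pair in Ht; rewrite comp_pair in Lt; rewrite !comp_pair in Ma.
destruct (B2 _ _ _ (c ∘ e2) _ Mb Hp) as [q' Hq'].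
destruct (app_mono Lp (leq_refl (c ∘ e2)) Hq') as [t' [Ht' Lt']].
rewrite <- (pf_at_fun Ht Ht') in Lt'.
destruct (RU _ _ _ _ Mc Ma) as [s [Hs Ms]].
destruct (RV _ _ _ _ Md Ms) as [w [Hw Mw]].
destruct (B3 _ _ _ _ _ _ _ _ _ Mb Hp Hq' Hs Hw) as [v [Hv Lv]].
destruct (app_mono (leq_trans Lt Lt') (leq_refl _) Hv) as [v' [Hv' Lv']].
rewrite <- !comp_pair in Hv'.
destruct (pf_at_local He2 Hv') as [v1 [Hv1 E1]].
destruct (pf_at_local He1 Hv1) as [v0 [Hv0 E0]].
exists v0; split; [exact Hv0|].
apply (mem_local He1), (mem_local He2); rewrite !comp_pair, E0, E1.
apply (ddown (leq_trans Lv' Lv)).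
now rewrite !comp_assoc in *.
Qed.

Definition DCat : Category.
Proof.
refine {| Ob := DOb; Hom := DHom;
  idm := fun P => exist _ (idm (dbase P)) (realizable_id P);
  comp := fun P Q R g f => exist _ (proj1_sig g ∘ proj1_sig f)
            (realizable_comp (proj2_sig g) (proj2_sig f)) |}.
- abstract (intros; apply DHom_eq, comp_idl).
- abstract (intros; apply DHom_eq, comp_idr).
- abstract (intros; apply DHom_eq, comp_assoc).
Defined.

Definition DFib : Functor DCat H.
Proof.
refine {| fob := (fun P : DCat => dbase P) : DCat -> H;
          fmap := fun P Q (f : @Hom DCat P Q) => proj1_sig f |}.
- abstract reflexivity.
- abstract reflexivity.
Defined.

Definition ring_filter : DCat :=
  {| dbase := A; dpred := leq A;
     ddown := fun T (a b x : Hom T A) => @leq_trans _ A T a b x |}.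

End Realizability.

(* Reindexing and coindexing are defined up to vertical isomorphism, so they are
   treated as relations and every condition is required of all choices. *)
Section Fibred.
Context (B : FinLim) (E : Category) (F : Functor E B).

Definition is_prone (P Q : E) (g : Hom P Q) : Prop :=
  forall R (h : Hom R Q) (k : Hom (F R) (F P)), fmap F g ∘ k = fmap F h ->
    exists! l : Hom R P, fmap F l = k /\ g ∘ l = h.

Definition is_supine (P Q : E) (g : Hom P Q) : Prop :=
  forall R (h : Hom P R) (k : Hom (F Q) (F R)), k ∘ fmap F g = fmap F h ->
    exists! l : Hom Q R, fmap F l = k /\ l ∘ g = h.

Definition is_vertical (P Q : E) (g : Hom P Q) : Prop :=
  exists X : B, arr_eq (fmap F g) (idm X).

Definition fib_le (P Q : E) : Prop := exists g : Hom P Q, is_vertical g.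
Definition fib_equiv (P Q : E) : Prop := fib_le P Q /\ fib_le Q P.

(* [reindex f Q P]: [P] is [F_f(Q)], which is determined up to [fib_equiv] *)
Definition reindex (X Y : B) (f : Hom X Y) (Q P : E) : Prop :=
  exists g : Hom P Q, is_prone g /\ arr_eq (fmap F g) f.

(* [coindex f P Q]: [Q] is [∃_f(P)] *)
Definition coindex (X Y : B) (f : Hom X Y) (P Q : E) : Prop :=
  exists g : Hom P Q, is_supine g /\ arr_eq (fmap F g) f.

Definition is_top (X : B) (T : E) : Prop :=
  F T = X /\ forall P, F P = X -> fib_le P T.

Definition is_meet (P Q M : E) : Prop :=
  fib_le M P /\ fib_le M Q /\ forall R, fib_le R P -> fib_le R Q -> fib_le R M.

Record fibred_locale : Prop := {
  fl_faithful : forall (P Q : E) (g h : Hom P Q), fmap F g = fmap F h -> g = h;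
  fl_prone : forall X (Q : E) (f : Hom X (F Q)), exists P, reindex f Q P;
  fl_supine : forall Y (P : E) (f : Hom (F P) Y), exists Q, coindex f P Q;
  fl_top : forall X : B, exists T, is_top X T;
  fl_meet : forall P Q : E, F P = F Q -> exists M, is_meet P Q M;
  fl_reindex_top : forall X Y (f : Hom X Y) T T',
    is_top Y T -> reindex f T T' -> is_top X T';
  fl_reindex_meet : forall X Y (f : Hom X Y) P Q M P' Q' M',
    is_meet P Q M -> reindex f P P' -> reindex f Q Q' -> reindex f M M' ->
    is_meet P' Q' M';
  fl_beck_chevalley : forall W X Y Z (a : Hom W X) (b : Hom W Y)
    (f : Hom X Z) (g : Hom Y Z) P P' Q Q' R,
    is_pullback a b f g ->
    coindex f P Q -> reindex g Q Q' -> reindex a P P' -> coindex b P' R ->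
    fib_equiv Q' R;
  fl_frobenius : forall X Y (f : Hom X Y) P Q Q' M N P' M',
    reindex f Q Q' -> is_meet P Q' M -> coindex f M N ->
    coindex f P P' -> is_meet P' Q M' -> fib_equiv N M'
}.

Definition separated : Prop :=
  forall X Y (e : Hom X Y) T T', is_regular_epi e ->
    is_top X T -> coindex e T T' -> is_top Y T'.

(* [leq A] and [pdom (app A)] are the objects {(x, y) : x <= y} and [D]. *)
Record vertical_filter (A : OPAS B) (C : E) : Prop := {
  vf_over : F C = A;
  vf_leq : forall P Q,
    reindex (pr1 ∘ sarr (leq A)) C P -> reindex (pr2 ∘ sarr (leq A)) C Q ->
    fib_le P Q;
  vf_app : forall P Q M R,
    reindex (pr1 ∘ sarr (pdom (app A))) C P ->
    reindex (pr2 ∘ sarr (pdom (app A))) C Q ->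
    is_meet P Q M -> reindex (pval (app A)) C R -> fib_le M R
}.

End Fibred.

Record vertical_morphism (B : FinLim) (E E' : Category) (F : Functor E B)
    (F' : Functor E' B) (K : Functor E E') : Prop := {
  (* on identities this gives [F' (K P) = F P] *)
  vm_over : forall (P Q : E) (g : Hom P Q), arr_eq (fmap F' (fmap K g)) (fmap F g);
  vm_prone : forall (P Q : E) (g : Hom P Q), is_prone F g -> is_prone F' (fmap K g);
  vm_supine : forall (P Q : E) (g : Hom P Q), is_supine F g -> is_supine F' (fmap K g);
  vm_top : forall X T, is_top F X T -> is_top F' X (K T);
  vm_meet : forall P Q M, is_meet F P Q M -> is_meet F' (K P) (K Q) (K M)
}.

Record is_fibred_model (H : RegularCategory) (A : OPAS H) (phi : ExternalFilter A)
    (E : Category) (F : Functor E H) (C : E) : Prop := {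
  fm_locale : fibred_locale F;
  fm_separated : separated F;
  fm_filter : vertical_filter F A C;
  fm_supine : forall U, phi U -> forall P T (g : Hom P T),
    reindex F (sarr U) C P -> is_terminal T -> is_supine F g
}.

Record FibredModel (H : RegularCategory) (A : OPAS H) (phi : ExternalFilter A) := {
  fm_cat : Category;
  fm_fun : Functor fm_cat H;
  fm_obj : fm_cat;
  fm_ok : is_fibred_model phi fm_fun fm_obj
}.

Arguments fm_obj {_ _ _} _.
Arguments fm_fun {_ _ _} _.

Record ModelMorphism (H : RegularCategory) (A : OPAS H) (phi : ExternalFilter A)
    (M N : FibredModel phi) := {
  mm_fun : Functor (fm_cat M) (fm_cat N);
  mm_vertical : vertical_morphism (fm_fun M) (fm_fun N) mm_fun;
  mm_arr : Hom (mm_fun (fm_obj M)) (fm_obj N);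
  mm_arr_vertical : is_vertical (fm_fun N) mm_arr;
  mm_arr_iso : is_iso mm_arr
}.

Record Model2Morphism (H : RegularCategory) (A : OPAS H) (phi : ExternalFilter A)
    (M N : FibredModel phi) (h k : ModelMorphism M N) := {
  m2_comp : forall P, Hom (mm_fun h P) (mm_fun k P);
  m2_nat : forall P Q (g : Hom P Q),
    m2_comp Q ∘ fmap (mm_fun h) g = fmap (mm_fun k) g ∘ m2_comp P;
  m2_vertical : forall P, is_vertical (fm_fun N) (m2_comp P);
  m2_iso : forall P, is_iso (m2_comp P);
  m2_filter : mm_arr k ∘ m2_comp (fm_obj M) = mm_arr h
}.

Definition pseudoinitial (H : RegularCategory) (A : OPAS H) (phi : ExternalFilter A)
    (I : FibredModel phi) : Prop :=
  forall M : FibredModel phi,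
    inhabited (ModelMorphism I M) /\
    forall h k : ModelMorphism I M, inhabited (Model2Morphism h k).

(* Main.v *)
(* Write a predicate [P ⊆ A × X] as a span [a : P -> A], [x : P -> X].  In the
   realizability fibration [P] is [∃_x(a^* ring_filter)], and vertical morphisms
   preserve this expression, so a morphism of models is determined by the image of
   [ring_filter], up to isomorphism.  Conversely, in a model [(F, C)] put
   [K(P) = ∃_x(a^* C)].  An arrow realized by [U] is sent to an arrow because [C|U -> 1]
   is supine: by Beck-Chevalley and Frobenius one may assume locally that a realizer
   [u ∈ U] with [C(u)] is given, and [C] is closed under application.  Images along
   regular epimorphisms are preserved because [F] is separated, and meets because [C]
   also contains, locally, a realizer of the pairing combinator. *)
From Stdlib Require Import ProofIrrelevance IndefiniteDescription.
Require Import Defs.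

Set Implicit Arguments.
Unset Strict Implicit.
Unset Printing Implicit Defensive.

(** Hence nontrivial realizers are built without choosing combinators, by applying members of [phi]
    to each other and tracking properties that are downward closed and descend along regular
    epimorphisms. For the same reason the fibrewise meet quantifies existentially over the realizer
    of pairing instead of fixing one. Coherence is no obstacle: the projection is faithful, so
    parallel arrows over the same base arrow agree, and functor laws, naturality and the condition
    on the vertical isomorphisms reduce to the existence of arrows over prescribed base arrows. What
    needs care is the end points, since an object lies over [X] only through an equation
    [F P = X]. *)

(** * Equality of arrows with different end points *)

Lemma arr_eq_ends (C : Category) (X Y X' Y' : C) (f : Hom X Y) (f' : Hom X' Y') :
  arr_eq f f' -> X = X' /\ Y = Y'.
Proof. now intros []. Qed.

Lemma arr_eq_eq (C : Category) (X Y : C) (f g : Hom X Y) : arr_eq f g -> f = g.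
Proof.
(* With fixed end points [arr_eq] cannot be eliminated. The end points are therefore freed, at the
   price of transports along equations that proof irrelevance makes trivial. *)
assert (K : forall X' Y' (h : Hom X' Y'), arr_eq f h -> forall (p : X' = X) (q : Y' = Y),
  f = eq_rect _ (fun y => Hom X y) (eq_rect _ (fun x => Hom x Y') h _ p) _ q).
{ intros X' Y' h [] p q.
  now rewrite (proof_irrelevance _ p eq_refl), (proof_irrelevance _ q eq_refl). }
intros E; exact (K _ _ _ E eq_refl eq_refl).
Qed.

Lemma arr_eq_sym (C : Category) (X Y X' Y' : C) (f : Hom X Y) (f' : Hom X' Y') :
  arr_eq f f' -> arr_eq f' f.
Proof. now intros []. Qed.

Lemma arr_eq_trans (C : Category) (X Y X' Y' X'' Y'' : C)
    (f : Hom X Y) (f' : Hom X' Y') (f'' : Hom X'' Y'') :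
  arr_eq f f' -> arr_eq f' f'' -> arr_eq f f''.
Proof. now intros []. Qed.

Lemma arr_eq_comp (C : Category) (X Y Z X' Y' Z' : C)
    (g : Hom Y Z) (f : Hom X Y) (g' : Hom Y' Z') (f' : Hom X' Y') :
  arr_eq g g' -> arr_eq f f' -> arr_eq (g ∘ f) (g' ∘ f').
Proof.
intros Eg Ef; revert g' Eg; destruct Ef; intros g' Eg.
destruct (proj2 (arr_eq_ends Eg)).
rewrite (arr_eq_eq Eg); constructor.
Qed.

(** * Fibred preorders *)

Section Over.
Context (B : FinLim) (E : Category) (F : Functor E B).

(* As [F] is faithful, arrows of [E] matter only through this relation. *)
Definition ov (X Y : B) (f : Hom X Y) (P Q : E) : Prop :=
  exists g : Hom P Q, arr_eq (fmap F g) f.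

Lemma ov_fmap (P Q : E) (g : Hom P Q) : ov (fmap F g) P Q.
Proof. exists g; constructor. Qed.

Lemma ov_dom (X Y : B) (f : Hom X Y) P Q : ov f P Q -> F P = X.
Proof. intros [g G]; exact (proj1 (arr_eq_ends G)). Qed.

Lemma ov_cod (X Y : B) (f : Hom X Y) P Q : ov f P Q -> F Q = Y.
Proof. intros [g G]; exact (proj2 (arr_eq_ends G)). Qed.

Lemma ov_arr (P Q : E) (f : Hom (F P) (F Q)) :
  ov f P Q -> exists g : Hom P Q, fmap F g = f.
Proof. intros [g G]; exists g; exact (arr_eq_eq G). Qed.

Lemma ov_idm (P : E) (X : B) : F P = X -> ov (idm X) P P.
Proof. intros []; exists (idm P); rewrite fmap_id; constructor. Qed.

Lemma ov_comp (X Y Z : B) (g : Hom Y Z) (f : Hom X Y) P Q R :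
  ov g Q R -> ov f P Q -> ov (g ∘ f) P R.
Proof.
intros [b Hb] [a Ha]; exists (b ∘ a); rewrite fmap_comp; now apply arr_eq_comp.
Qed.

Lemma vertical_over (P Q : E) (g : Hom P Q) (X : B) :
  is_vertical F g -> F P = X -> arr_eq (fmap F g) (idm X).
Proof.
intros [Y G] EX; destruct (arr_eq_ends G) as [E1 _]; now replace X with Y by congruence.
Qed.

Lemma vertical_comp_l (P Q R : E) (v : Hom Q R) (g : Hom P Q) (X Y : B) (f : Hom X Y) :
  is_vertical F v -> arr_eq (fmap F g) f -> arr_eq (fmap F (v ∘ g)) f.
Proof.
intros V G; rewrite fmap_comp, <- (comp_idl f); apply arr_eq_comp; [|exact G].
exact (vertical_over V (proj2 (arr_eq_ends G))).
Qed.

Lemma vertical_comp_r (P Q R : E) (g : Hom Q R) (v : Hom P Q) (X Y : B) (f : Hom X Y) :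
  is_vertical F v -> arr_eq (fmap F g) f -> arr_eq (fmap F (g ∘ v)) f.
Proof.
intros V G; rewrite fmap_comp, <- (comp_idr f); apply arr_eq_comp; [exact G|].
apply (vertical_over V); destruct V as [Z K], (arr_eq_ends K), (arr_eq_ends G); congruence.
Qed.

Lemma fib_le_ov (P Q : E) (X : B) : F P = X -> fib_le F P Q -> ov (idm X) P Q.
Proof. intros EX [g V]; exists g; exact (vertical_over V EX). Qed.

Lemma ov_fib_le (P Q : E) (X : B) : ov (idm X) P Q -> fib_le F P Q.
Proof. intros [g G]; now exists g, X. Qed.

Lemma fib_le_over (P Q : E) : fib_le F P Q -> F P = F Q.
Proof. intros [g [Y G]]; destruct (arr_eq_ends G); congruence. Qed.

Lemma fib_le_refl (P : E) : fib_le F P P.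
Proof. apply (@ov_fib_le _ _ (F P)); now apply ov_idm. Qed.

Lemma ov_le_l (X Y : B) (f : Hom X Y) P Q R : fib_le F P Q -> ov f Q R -> ov f P R.
Proof.
intros L O; rewrite <- (comp_idr f); apply (ov_comp O), fib_le_ov; [|exact L].
rewrite (fib_le_over L); exact (ov_dom O).
Qed.

Lemma ov_le_r (X Y : B) (f : Hom X Y) P Q R : ov f P Q -> fib_le F Q R -> ov f P R.
Proof.
intros O L; rewrite <- (comp_idl f); refine (ov_comp _ O); apply fib_le_ov; [|exact L].
exact (ov_cod O).
Qed.

Lemma fib_le_trans (P Q R : E) : fib_le F P Q -> fib_le F Q R -> fib_le F P R.
Proof.
intros L M; apply (@ov_fib_le _ _ (F P)); refine (ov_le_r _ M); now apply fib_le_ov.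
Qed.

Context (faithful : forall (P Q : E) (g h : Hom P Q), fmap F g = fmap F h -> g = h).

Lemma faithful_arr_eq (P Q : E) (X Y : B) (f : Hom X Y) (g h : Hom P Q) :
  arr_eq (fmap F g) f -> arr_eq (fmap F h) f -> g = h.
Proof.
intros Eg Eh; apply faithful, arr_eq_eq, (arr_eq_trans Eg), arr_eq_sym, Eh.
Qed.

Lemma vertical_iso (P Q : E) (g : Hom P Q) : is_vertical F g -> fib_le F Q P -> is_iso g.
Proof.
intros V [h W]; exists h; destruct V as [X G], (arr_eq_ends G) as [E1 E2].
pose proof (vertical_over W E2) as K.
split; apply (@faithful_arr_eq _ _ X X (idm X)).
- apply vertical_comp_l; [exact W|exact G].
- rewrite fmap_id, E1; constructor.
- apply vertical_comp_l; [now exists X|exact K].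
- rewrite fmap_id, E2; constructor.
Qed.

(** Faithfulness supplies the uniqueness and the commutation of the lift, so only its existence has
    to be tested. *)
Lemma prone_ov (P Q : E) (g : Hom P Q) :
  is_prone F g <->
  forall R (k : Hom (F R) (F P)), ov (fmap F g ∘ k) R Q -> ov k R P.
Proof.
split.
- intros Hg R k O; destruct (ov_arr O) as [h Eh].
  destruct (Hg R h k (eq_sym Eh)) as [l [[<- _] _]]; apply ov_fmap.
- intros U R h k Eh.
  destruct (@ov_arr R P k) as [l El].
  { apply U; rewrite Eh; apply ov_fmap. }
  exists l; split; [split|].
  + exact El.
  + apply faithful; now rewrite fmap_comp, El.
  + intros l' [El' _]; apply faithful; congruence.
Qed.

Lemma supine_ov (P Q : E) (g : Hom P Q) :
  is_supine F g <->
  forall R (k : Hom (F Q) (F R)), ov (k ∘ fmap F g) P R -> ov k Q R.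
Proof.
split.
- intros Hg R k O; destruct (ov_arr O) as [h Eh].
  destruct (Hg R h k (eq_sym Eh)) as [l [[<- _] _]]; apply ov_fmap.
- intros U R h k Eh.
  destruct (@ov_arr Q R k) as [l El].
  { apply U; rewrite Eh; apply ov_fmap. }
  exists l; split; [split|].
  + exact El.
  + apply faithful; now rewrite fmap_comp, El.
  + intros l' [El' _]; apply faithful; congruence.
Qed.

(** Here and in [coindexI], [reindex_lift] and [coindex_desc], the universal property is stated for
    arbitrary base arrows, so that equations such as [F R = X'] are eliminated once and not in each
    use. *)
Lemma reindexI (X Y : B) (f : Hom X Y) P Q :
  ov f P Q -> (forall R X' (k : Hom X' X), ov (f ∘ k) R Q -> ov k R P) ->
  reindex F f Q P.
Proof.
intros [g []] U; exists g; split; [|constructor].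
apply prone_ov; intros R k; apply U.
Qed.

Lemma coindexI (X Y : B) (f : Hom X Y) P Q :
  ov f P Q -> (forall R Y' (k : Hom Y Y'), ov (k ∘ f) P R -> ov k Q R) ->
  coindex F f P Q.
Proof.
intros [g []] U; exists g; split; [|constructor].
apply supine_ov; intros R k; apply U.
Qed.

Lemma reindex_ov (X Y : B) (f : Hom X Y) P Q : reindex F f Q P -> ov f P Q.
Proof. intros [g [_ G]]; now exists g. Qed.

Lemma coindex_ov (X Y : B) (f : Hom X Y) P Q : coindex F f P Q -> ov f P Q.
Proof. intros [g [_ G]]; now exists g. Qed.

Lemma reindex_lift (X Y : B) (f : Hom X Y) P Q R X' (k : Hom X' X) :
  reindex F f Q P -> ov (f ∘ k) R Q -> ov k R P.
Proof.
intros [g [Hg G]]; revert k; destruct G; intros k O; pose proof (ov_dom O); subst X'.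
now apply (proj1 (prone_ov g) Hg).
Qed.

Lemma coindex_desc (X Y : B) (f : Hom X Y) P Q R Y' (k : Hom Y Y') :
  coindex F f P Q -> ov (k ∘ f) P R -> ov k Q R.
Proof.
intros [g [Hg G]]; revert k; destruct G; intros k O; pose proof (ov_cod O); subst Y'.
now apply (proj1 (supine_ov g) Hg).
Qed.

Lemma reindex_le (X Y : B) (f : Hom X Y) P Q R :
  reindex F f Q P -> ov f R Q -> fib_le F R P.
Proof.
intros I O; apply (@ov_fib_le _ _ X), (reindex_lift I); now rewrite comp_idr.
Qed.

Lemma coindex_le (X Y : B) (f : Hom X Y) P Q R :
  coindex F f P Q -> ov f P R -> fib_le F Q R.
Proof.
intros I O; apply (@ov_fib_le _ _ Y), (coindex_desc I); now rewrite comp_idl.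
Qed.

Lemma prone_reindex (P Q : E) (g : Hom P Q) :
  is_prone F g <-> reindex F (fmap F g) Q P.
Proof.
split.
- intros Hg; exists g; split; [exact Hg|constructor].
- intros I; apply prone_ov; intros R k; now apply reindex_lift.
Qed.

Lemma supine_coindex (P Q : E) (g : Hom P Q) :
  is_supine F g <-> coindex F (fmap F g) P Q.
Proof.
split.
- intros Hg; exists g; split; [exact Hg|constructor].
- intros I; apply supine_ov; intros R k; now apply coindex_desc.
Qed.

Lemma is_meetI (X : B) (P Q M : E) :
  ov (idm X) M P -> ov (idm X) M Q ->
  (forall R, ov (idm X) R P -> ov (idm X) R Q -> ov (idm X) R M) -> is_meet F P Q M.
Proof.
intros M1 M2 U; split; [|split]; [now apply (@ov_fib_le _ _ X)..|].
intros R L1 L2; assert (ER : F R = X).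
{ rewrite (fib_le_over L1); exact (ov_cod M1). }
apply (@ov_fib_le _ _ X), U; now apply fib_le_ov.
Qed.

Lemma reindex_meet_le (X Y : B) (f : Hom X Y) P Q M P' Q' M' :
  is_meet F P Q M -> reindex F f P P' -> reindex F f Q Q' -> reindex F f M M' ->
  fib_le F M' P' /\ fib_le F M' Q'.
Proof.
intros [M1 [M2 _]] IP IQ IM; split.
- apply (reindex_le IP); exact (ov_le_r (reindex_ov IM) M1).
- apply (reindex_le IQ); exact (ov_le_r (reindex_ov IM) M2).
Qed.

(* Reindexing is a right adjoint, hence preserves finite meets. *)
Section Coindexing.
Context (supine : forall X Y (f : Hom X Y) (P : E), F P = X -> exists Q, coindex F f P Q).

Lemma reindex_top_of_coindex (X Y : B) (f : Hom X Y) T T' :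
  is_top F Y T -> reindex F f T T' -> is_top F X T'.
Proof.
intros [ET UT] I; pose proof (reindex_ov I) as O; split; [exact (ov_dom O)|].
intros P EP; destruct (supine f EP) as [Q HQ].
apply (reindex_le I); refine (ov_le_r (coindex_ov HQ) (UT Q _)).
exact (ov_cod (coindex_ov HQ)).
Qed.

Lemma reindex_meet_of_coindex (X Y : B) (f : Hom X Y) P Q M P' Q' M' :
  is_meet F P Q M -> reindex F f P P' -> reindex F f Q Q' -> reindex F f M M' ->
  is_meet F P' Q' M'.
Proof.
intros HM IP IQ IM; destruct (reindex_meet_le HM IP IQ IM) as [L1 L2].
split; [exact L1|split; [exact L2|]]; destruct HM as [_ [_ UM]].
intros R R1 R2.
pose proof (ov_le_l R1 (reindex_ov IP)) as O1.
pose proof (ov_le_l R2 (reindex_ov IQ)) as O2.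
destruct (supine f (ov_dom O1)) as [S HS].
apply (reindex_le IM); refine (ov_le_r (coindex_ov HS) (UM S _ _)).
- exact (coindex_le HS O1).
- exact (coindex_le HS O2).
Qed.

End Coindexing.

(* By uniqueness of the operations, the nontrivial halves of Beck-Chevalley and
   Frobenius need only be checked for one choice of them. *)
Lemma beck_chevalley_of_choice (W X Y Z : B) (a : Hom W X) (b : Hom W Y)
    (f : Hom X Z) (g : Hom Y Z) P P' Q Q' R P1 Q1 Q1' R1 :
  f ∘ a = g ∘ b ->
  coindex F f P Q1 -> reindex F g Q1 Q1' -> reindex F a P P1 -> coindex F b P1 R1 ->
  fib_le F Q1' R1 ->
  coindex F f P Q -> reindex F g Q Q' -> reindex F a P P' -> coindex F b P' R ->
  fib_equiv F Q' R.
Proof.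
intros S C1 I1 J1 D1 L C I J D; split.
- apply (fib_le_trans (Q := Q1')); [|apply (fib_le_trans L)].
  + apply (reindex_le I1), (ov_le_r (reindex_ov I)), (coindex_le C), coindex_ov, C1.
  + apply (coindex_le D1); refine (ov_le_l _ (coindex_ov D)).
    apply (reindex_le J), reindex_ov, J1.
- apply (@ov_fib_le _ _ Y), (coindex_desc D), (reindex_lift I).
  rewrite comp_idl, <- S; exact (ov_comp (coindex_ov C) (reindex_ov J)).
Qed.

Lemma frobenius_of_choice (X Y : B) (f : Hom X Y) P Q Q' M N P' M' Q1 M1 N1 P1 M1' :
  reindex F f Q Q1 -> is_meet F P Q1 M1 -> coindex F f M1 N1 ->
  coindex F f P P1 -> is_meet F P1 Q M1' -> fib_le F M1' N1 ->
  reindex F f Q Q' -> is_meet F P Q' M -> coindex F f M N ->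
  coindex F f P P' -> is_meet F P' Q M' -> fib_equiv F N M'.
Proof.
intros I1 [A1 [A2 A3]] C1 D1 [B1 [B2 B3]] L I [U1 [U2 U3]] C D [V1 [V2 V3]]; split.
- apply V3.
  + apply (coindex_le C); exact (ov_le_l U1 (coindex_ov D)).
  + apply (coindex_le C); exact (ov_le_l U2 (reindex_ov I)).
- apply (fib_le_trans (Q := M1')); [|apply (fib_le_trans L)].
  + apply B3; [|exact V2].
    apply (fib_le_trans V1), (coindex_le D), coindex_ov, D1.
  + apply (coindex_le C1); refine (ov_le_l _ (coindex_ov C)); apply U3; [exact A1|].
    apply (fib_le_trans A2), (reindex_le I), reindex_ov, I1.
Qed.

End Over.

(** * Maps into tops and meets, and covers in a fibred locale *)

Section FibredLocale.
Context (B : FinLim) (E : Category) (F : Functor E B) (FL : fibred_locale F).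

Let faithful := fl_faithful FL.

Lemma prone_lift (X Y : B) (f : Hom X Y) (Q : E) : F Q = Y -> exists P, reindex F f Q P.
Proof. intros EQ; subst Y; apply (fl_prone FL). Qed.

Lemma supine_lift (X Y : B) (f : Hom X Y) (P : E) : F P = X -> exists Q, coindex F f P Q.
Proof. intros EP; subst X; apply (fl_supine FL). Qed.

Lemma top_ov (X Y : B) (f : Hom X Y) P T : is_top F Y T -> F P = X -> ov F f P T.
Proof.
intros HT EP; destruct (prone_lift f (proj1 HT)) as [T' I].
refine (ov_le_l _ (reindex_ov I)); now apply (fl_reindex_top FL HT I).
Qed.

Lemma meet_ov (X Y : B) (f : Hom X Y) P Q M R :
  is_meet F P Q M -> ov F f R P -> ov F f R Q -> ov F f R M.
Proof.
intros HM OP OQ.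
assert (EM : F M = Y).
{ rewrite (fib_le_over (proj1 HM)); exact (ov_cod OP). }
destruct (prone_lift f (ov_cod OP)) as [P' IP].
destruct (prone_lift f (ov_cod OQ)) as [Q' IQ].
destruct (prone_lift f EM) as [M' IM].
refine (ov_le_l _ (reindex_ov IM)); apply (fl_reindex_meet FL HM IP IQ IM).
- exact (reindex_le faithful IP OP).
- exact (reindex_le faithful IQ OQ).
Qed.

(** Links the fibrewise top over [one] with the terminal objects of the total category in terms of
    which [fm_supine] is stated. *)
Lemma terminal_top (T : E) : is_top F one T -> is_terminal T.
Proof.
intros HT P; destruct (top_ov (bang (F P)) HT eq_refl) as [g G].
exists g; split; [easy|]; intros g' _; apply faithful.
destruct HT as [ET _].
apply arr_eq_eq; apply (arr_eq_trans G); apply arr_eq_sym.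
clear G; generalize (fmap F g'); rewrite ET.
intros k; rewrite (bang_uniq k); constructor.
Qed.

(* Frobenius: if [R ≤ ∃_f(P)] then [R ≃ ∃_f(P ∧ F_f R)]. *)
Lemma cover_of_le (X Y : B) (f : Hom X Y) P Q R :
  coindex F f P Q -> fib_le F R Q ->
  exists R', coindex F f R' R /\ fib_le F R' P.
Proof.
intros C L; pose proof (coindex_ov C) as O.
assert (ER : F R = Y) by (rewrite (fib_le_over L); exact (ov_cod O)).
destruct (prone_lift f ER) as [Q' I].
destruct (fl_meet FL (P := P) (Q := Q')) as [M HM].
{ rewrite (ov_dom O); symmetry; exact (ov_dom (reindex_ov I)). }
assert (EM : F M = X).
{ rewrite (fib_le_over (proj1 HM)); exact (ov_dom O). }
destruct (supine_lift f EM) as [N CN].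
destruct (fl_meet FL (P := Q) (Q := R)) as [M' HM'].
{ symmetry; exact (fib_le_over L). }
destruct (fl_frobenius FL I HM CN C HM') as [_ L'].
exists M; split; [|exact (proj1 HM)].
apply (coindexI faithful).
- exact (ov_le_l (proj1 (proj2 HM)) (reindex_ov I)).
- intros S Y' k OS; apply (@ov_le_l _ _ _ _ _ _ _ N); [|exact (coindex_desc faithful CN OS)].
  refine (fib_le_trans _ L'); apply HM'; [exact L|apply fib_le_refl].
Qed.

End FibredLocale.
(** * Combinatory completeness *)

Ltac project :=
  cbn [pow Nat.add];
  repeat (rewrite comp_pair || rewrite <- comp_assoc || rewrite pr1_pair || rewrite pr2_pair).

Section Internal.
Context (H : HeytingCategory).

Lemma regular_epi_id (X : H) : is_regular_epi (idm X).
Proof.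
exists X, (idm X), (idm X); split; [reflexivity|].
intros Z g _; exists g; split; [apply comp_idr|].
intros h Eh; now rewrite comp_idr in Eh.
Qed.

Lemma regular_epi_pb (X Y T : H) (e : Hom X Y) (y : Hom T Y) :
  is_regular_epi e ->
  exists T' (e' : Hom T' T) (x : Hom T' X), is_regular_epi e' /\ e ∘ x = y ∘ e'.
Proof.
intros He; exists (pbk e y), (pbk2 e y), (pbk1 e y); split.
- exact (reg_stable (pbkP e y) He).
- exact (proj1 (pbkP e y)).
Qed.

Lemma mem_exI (X Y T T' : H) (f : Hom X Y) (S : Sub X) (y : Hom T Y)
    (e : Hom T' T) (x : Hom T' X) :
  is_regular_epi e -> x ∈ S -> f ∘ x = y ∘ e -> y ∈ sub_ex f S.
Proof.
intros He [s Es] Ex; apply (mem_local He).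
exists (im_e (f ∘ sarr S) ∘ s); unfold sub_ex.
now rewrite comp_assoc, im_fact, <- comp_assoc, Es.
Qed.

Lemma times_pair (T A X Y : H) (f : Hom X Y) (a : Hom T A) (x : Hom T X) :
  ⟨pr1, f ∘ pr2⟩ ∘ ⟨a, x⟩ = ⟨a, f ∘ x⟩.
Proof. now rewrite comp_pair, <- comp_assoc, pr1_pair, pr2_pair. Qed.

Context (A : OPAS H).

Implicit Types (U V : Sub A) (P Q R : DOb A).

(** An element of [sub_app U V] lies below an application of an element of [U] to one of [V] only
    after a regular epimorphism. Downward closure and locality are what carries a property of such
    applications over to it. *)
Record local_pred (Φ : forall T : H, Hom T A -> Prop) : Prop := {
  lp_comp : forall T T' (u : Hom T A) (t : Hom T' T), Φ T u -> Φ T' (u ∘ t);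
  lp_down : forall T (u u' : Hom T A), ⟨u, u'⟩ ∈ leq A -> Φ T u' -> Φ T u;
  lp_local : forall T T' (u : Hom T A) (e : Hom T' T),
    is_regular_epi e -> Φ T' (u ∘ e) -> Φ T u
}.

(** The quantification over all [t] into [T], here and in [realizes], is the Kripke-Joyal meaning of
    an internal universal quantifier. *)
Definition imp V (Φ : forall T : H, Hom T A -> Prop) (T : H) (q : Hom T A) : Prop :=
  forall T' (t : Hom T' T) (y : Hom T' A), y ∈ V ->
    exists w, pf_at (app A) ⟨q ∘ t, y⟩ w /\ Φ T' w.

Definition realizes P Q (f : Hom (dbase P) (dbase Q)) (T : H) (q : Hom T A) : Prop :=
  forall T' (t : Hom T' T) (a : Hom T' A) (x : Hom T' (dbase P)), ⟨a, x⟩ ∈ dpred P ->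
    exists w, pf_at (app A) ⟨q ∘ t, a⟩ w /\ ⟨w, f ∘ x⟩ ∈ dpred Q.

(** Locality rests on application being single valued: a value found after a regular epimorphism
    descends along it. *)
Lemma local_imp V Φ : local_pred Φ -> local_pred (imp V Φ).
Proof.
intros L; split.
- intros T T' u s K T'' t y My; rewrite <- comp_assoc; now apply K.
- intros T u u' Lu K T' t y My; destruct (K _ t y My) as [w' [Hw' F]].
  apply (mem_comp t) in Lu; rewrite comp_pair in Lu.
  destruct (app_mono Lu (leq_refl y) Hw') as [w [Hw Lw]].
  exists w; split; [exact Hw|exact (lp_down L Lw F)].
- intros T T0 u e He K T' t y My.
  destruct (regular_epi_pb t He) as [T'' [e' [x [He' Ex]]]].
  destruct (K _ x _ (mem_comp e' My)) as [w [Hw F]].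
  rewrite <- comp_assoc, Ex, comp_assoc, <- comp_pair in Hw.
  destruct (pf_at_local He' Hw) as [w0 [Hw0 <-]].
  exists w0; split; [exact Hw0|exact (lp_local L He' F)].
Qed.

Lemma local_realizes P Q (f : Hom (dbase P) (dbase Q)) : local_pred (realizes f).
Proof.
split.
- intros T T' u s K T'' t a x Ma; rewrite <- comp_assoc; now apply K.
- intros T u u' Lu K T' t a x Ma; destruct (K _ t a x Ma) as [w' [Hw' F]].
  apply (mem_comp t) in Lu; rewrite comp_pair in Lu.
  destruct (app_mono Lu (leq_refl a) Hw') as [w [Hw Lw]].
  exists w; split; [exact Hw|exact (ddown Lw F)].
- intros T T0 u e He K T' t a x Ma.
  destruct (regular_epi_pb t He) as [T'' [e' [s [He' Es]]]].
  apply (mem_comp e') in Ma; rewrite comp_pair in Ma.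
  destruct (K _ s _ _ Ma) as [w [Hw F]].
  rewrite <- comp_assoc, Es, comp_assoc, <- comp_pair in Hw.
  destruct (pf_at_local He' Hw) as [w0 [Hw0 <-]].
  exists w0; split; [exact Hw0|].
  apply (mem_local He'); now rewrite comp_pair, <- comp_assoc.
Qed.

(** * Building realizers from combinators, one argument at a time *)

Section Filter.
Context (phi : ExternalFilter A) (phi_complete : ext_complete phi).

Definition sat (Φ : forall T : H, Hom T A -> Prop) : Prop :=
  exists U, phi U /\ forall T (u : Hom T A), u ∈ U -> Φ T u.

(** The rule by which realizers are constructed: to realize [Φ], find a realizer that still expects
    an argument from a known member [V] of [phi]. The definedness of [sub_app U V] is part of what
    [imp] provides. *)
Lemma sat_app V Φ : local_pred Φ -> phi V -> sat (imp V Φ) -> sat Φ.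
Proof.
intros L HV [U [HU K]].
assert (K' : forall T (x y : Hom T A), x ∈ U -> y ∈ V ->
  exists w, pf_at (app A) ⟨x, y⟩ w /\ Φ T w).
{ intros T x y Mx My; rewrite <- (comp_idr x); now apply K. }
assert (D : sub_app_def U V).
{ apply sub_app_defI; intros T x y Mx My.
  destruct (K' _ _ _ Mx My) as [w [Hw _]]; now exists w. }
exists (sub_app U V); split; [now apply ef_app|].
intros T z Mz; apply mem_sub_app in Mz.
destruct Mz as [T' [e [x [y [v [He [Mx [My [Hv Lv]]]]]]]]].
apply (lp_local L He), (lp_down L Lv).
destruct (K' _ _ _ Mx My) as [w [Hw F]]; now rewrite (pf_at_fun Hv Hw).
Qed.

Lemma realizable_sat P Q (f : Hom (dbase P) (dbase Q)) :
  realizable phi f <-> sat (realizes f).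
Proof.
split; intros [U [HU K]]; exists U; split; try exact HU.
- intros T u Mu T' t a x Ma; apply K; [now apply mem_comp|exact Ma].
- intros T u a x Mu Ma; rewrite <- (comp_idr u); now apply K.
Qed.

(* The values at [xs] of the k-fold applications of the realizers of [f]. *)
Definition part (n : nat) (f : PFun (pow A (S n)) A) (k : nat) (T : H)
    (xs : Hom T (pow A k)) (q : Hom T A) : Prop :=
  exists r, r ∈ realizers f /\ pf_at (iter_app A k) ⟨r, xs⟩ q.

Lemma part_zero (n : nat) (f : PFun (pow A (S n)) A) (T : H) (r : Hom T A) :
  r ∈ realizers f -> part f (k := 0) (bang T) r.
Proof. intros Mr; exists r; split; [exact Mr|now apply iter_appO]. Qed.

Lemma part_comp (n : nat) (f : PFun (pow A (S n)) A) k (T T' : H)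
    (xs : Hom T (pow A k)) (q : Hom T A) (t : Hom T' T) :
  part f xs q -> part f (xs ∘ t) (q ∘ t).
Proof.
intros [r [Mr Hr]]; exists (r ∘ t); split; [now apply mem_comp|].
apply (pf_at_comp t) in Hr; now rewrite comp_pair in Hr.
Qed.

Lemma iter_app_prefix (m k : nat) (T : H) (r : Hom T A) (xs : Hom T (pow A k)) :
  (forall ys : Hom T (pow A (m + k)), exists v, pf_at (iter_app A (m + k)) ⟨r, ys⟩ v) ->
  exists v, pf_at (iter_app A k) ⟨r, xs⟩ v.
Proof.
induction m as [|m IH]; intros K; [apply K|apply IH].
(* Any element can pad the tuple by its last entry; [r] is at hand. *)
intros ys; destruct (K ⟨ys, r⟩) as [v Hv].
apply (iter_appS r r v ys) in Hv; destruct Hv as [p [Hp _]]; now exists p.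
Qed.

(** Realizers of [f] are total in all arguments but the last one, whether or not [f] is defined.
    Here [m] counts the arguments between [x] and that last one, which [part_last] treats. *)
Lemma part_step (m k : nat) (f : PFun (pow A (S (m + S k))) A) (T : H)
    (xs : Hom T (pow A k)) (q x : Hom T A) :
  part f xs q -> exists w, pf_at (app A) ⟨q, x⟩ w /\ part f (k := S k) ⟨xs, x⟩ w.
Proof.
intros [r [Mr Hr]].
destruct (@iter_app_prefix m (S k) T r ⟨xs, x⟩) as [v Hv].
{ intros ys; exact (realizers_dom ys Mr). }
pose proof Hv as Hv'; apply iter_appS in Hv; destruct Hv as [p [Hp Hv]].
rewrite <- (pf_at_fun Hr Hp) in Hv.
exists v; split; [exact Hv|now exists r].
Qed.

Lemma part_last (n : nat) (f : PFun (pow A (S n)) A) (T : H)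
    (xs : Hom T (pow A n)) (q x v : Hom T A) :
  part f xs q -> pf_at f ⟨xs, x⟩ v ->
  exists w, pf_at (app A) ⟨q, x⟩ w /\ ⟨w, v⟩ ∈ leq A.
Proof.
intros [r [Mr Hr]] Hf; destruct (realizers_val Mr Hf) as [w [Hw L]].
apply iter_appS in Hw; destruct Hw as [p [Hp Hw]].
rewrite <- (pf_at_fun Hr Hp) in Hw; now exists w.
Qed.

Lemma part_imp (m k : nat) (f : PFun (pow A (S (m + S k))) A) (T : H)
    (xs : Hom T (pow A k)) (q : Hom T A) V Φ :
  part f xs q ->
  (forall T' (t : Hom T' T) (y w : Hom T' A), y ∈ V ->
    part f (k := S k) ⟨xs ∘ t, y⟩ w -> Φ T' w) ->
  imp V Φ q.
Proof.
intros Hq K T' t y My; destruct (part_step y (part_comp t Hq)) as [w [Hw Pw]].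
exists w; split; [exact Hw|exact (K _ _ _ _ My Pw)].
Qed.

Lemma part_realizes (n : nat) (f : PFun (pow A (S n)) A) (T : H)
    (xs : Hom T (pow A n)) (q : Hom T A) P Q (g : Hom (dbase P) (dbase Q)) :
  part f xs q ->
  (forall T' (t : Hom T' T) (a : Hom T' A) (x : Hom T' (dbase P)), ⟨a, x⟩ ∈ dpred P ->
    exists T'' (e : Hom T'' T') (v : Hom T'' A), is_regular_epi e /\
      pf_at f (⟨xs ∘ t, a⟩ ∘ e) v /\ ⟨v, g ∘ x ∘ e⟩ ∈ dpred Q) ->
  realizes g q.
Proof.
intros Hq K T' t a x Ma; destruct (K _ t _ _ Ma) as [T'' [e [v [He [Hv Mv]]]]].
apply (part_comp t), (part_comp e) in Hq; rewrite comp_pair in Hv.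
destruct (part_last Hq Hv) as [w [Hw L]]; rewrite <- comp_pair in Hw.
destruct (pf_at_local He Hw) as [w0 [Hw0 <-]].
exists w0; split; [exact Hw0|].
apply (mem_local He); rewrite comp_pair; exact (ddown L Mv).
Qed.

(** The identity combinator works: it gives a value below [a], and the target predicate is downward
    closed. *)
Lemma realizable_incl P Q (f : Hom (dbase P) (dbase Q)) :
  (forall T (a : Hom T A) (x : Hom T (dbase P)),
    ⟨a, x⟩ ∈ dpred P -> ⟨a, f ∘ x⟩ ∈ dpred Q) ->
  realizable phi f.
Proof.
intros K; pose (I := pf_total (pr2 : Hom (pow A 1) A)).
apply realizable_sat; exists (realizers I); split.
{ apply phi_complete, pcomb_proj, proj_last. }
intros T u Mu; apply (part_realizes (part_zero Mu)); intros T' t a x Ma.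
exists T', (idm _), a; split; [apply regular_epi_id|split].
- apply pf_at_total; rewrite comp_idr; apply pr2_pair.
- rewrite comp_idr; now apply K.
Qed.

End Filter.

(** * Operations on predicates *)

Definition reindex_pred (X Y : H) (f : Hom X Y) (S : Sub (prd A Y)) : Sub (prd A X) :=
  sub_pb ⟨pr1, f ∘ pr2⟩ S.

Lemma mem_reindex_pred (X Y T : H) (f : Hom X Y) S (a : Hom T A) (x : Hom T X) :
  ⟨a, x⟩ ∈ reindex_pred f S <-> ⟨a, f ∘ x⟩ ∈ S.
Proof. unfold reindex_pred; now rewrite mem_pb, times_pair. Qed.

Definition dreindex (X : H) Q (f : Hom X (dbase Q)) : DOb A.
Proof.
refine {| dbase := X; dpred := reindex_pred f (dpred Q) |}.
abstract (intros T a b x L; rewrite !mem_reindex_pred; exact (ddown L)).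
Defined.

Definition ex_pred (X Y : H) (f : Hom X Y) (S : Sub (prd A X)) : Sub (prd A Y) :=
  sub_ex ⟨pr1, f ∘ pr2⟩ S.

Lemma mem_ex_pred (X Y T : H) (f : Hom X Y) S (a : Hom T A) (y : Hom T Y) :
  ⟨a, y⟩ ∈ ex_pred f S <->
  exists T' (e : Hom T' T) (x : Hom T' X),
    is_regular_epi e /\ ⟨a ∘ e, x⟩ ∈ S /\ f ∘ x = y ∘ e.
Proof.
split.
- intros M; apply mem_ex in M; destruct M as [T' [e [z [He [Mz Ez]]]]].
  rewrite <- (pair_eta z) in Mz, Ez; rewrite times_pair, comp_pair in Ez.
  exists T', e, (pr2 ∘ z); split; [exact He|split].
  + now rewrite <- (pr1_pair (a ∘ e) (y ∘ e)), <- Ez, pr1_pair.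
  + now rewrite <- (pr2_pair (a ∘ e) (y ∘ e)), <- Ez, pr2_pair.
- intros [T' [e [x [He [Mx Ex]]]]]; apply (mem_exI He Mx).
  now rewrite times_pair, comp_pair, Ex.
Qed.

Definition dexists P (Y : H) (f : Hom (dbase P) Y) : DOb A.
Proof.
refine {| dbase := Y; dpred := ex_pred f (dpred P) |}.
abstract (intros T a b y L M; apply mem_ex_pred in M;
  destruct M as [T' [e [x [He [Mx Ex]]]]]; apply mem_ex_pred;
  exists T', e, x; split; [exact He|split; [|exact Ex]];
  apply (mem_comp e) in L; rewrite comp_pair in L; exact (ddown L Mx)).
Defined.

Definition dtop (X : H) : DOb A.
Proof.
refine {| dbase := X; dpred := sub_full (prd A X) |}.
abstract (intros; apply mem_full).
Defined.

(* (x, y, z) |-> z x y, the Church pairing *)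
Definition pair_comb : PFun (pow A 3) A :=
  papp (papp (pf_total (pr2 : Hom (pow A 3) A)) (pf_total (pr2 ∘ pr1 ∘ pr1 : Hom (pow A 3) A)))
    (pf_total (pr2 ∘ pr1 : Hom (pow A 3) A)).

Lemma pcomb_pair : pcomb pair_comb.
Proof.
apply pcomb_app; [apply pcomb_app|]; apply pcomb_proj; repeat constructor.
Qed.

Lemma pair_comb_at (T : H) (z : Hom T (pow A 0)) (a b k p q : Hom T A) :
  pf_at (app A) ⟨k, a⟩ p -> pf_at (app A) ⟨p, b⟩ q ->
  pf_at pair_comb ⟨⟨⟨z, a⟩, b⟩, k⟩ q.
Proof.
intros Hp Hq; apply pf_at_papp; exists p, b; split; [|split; [|exact Hq]].
- apply pf_at_papp; exists k, a; split; [|split; [|exact Hp]]; apply pf_at_total.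
  + apply pr2_pair.
  + now rewrite <- !comp_assoc, !pr1_pair, pr2_pair.
- apply pf_at_total; now rewrite <- !comp_assoc, pr1_pair, pr2_pair.
Qed.

(* {(c, x) | exists p realizing [pair_comb], (a, x) in S and (b, x) in S' such that
   c <= p a b}, in the context (c, x), (p, (a, b)) *)
Definition meet_pred (X : H) (S S' : Sub (prd A X)) : Sub (prd A X) :=
  sub_ex (pr1 : Hom (prd (prd A X) (prd A (prd A A))) (prd A X))
    (sub_meet
       (sub_meet (sub_pb (pr1 ∘ pr2) (realizers pair_comb))
          (sub_meet (sub_pb ⟨pr1 ∘ pr2 ∘ pr2, pr2 ∘ pr1⟩ S)
             (sub_pb ⟨pr2 ∘ pr2 ∘ pr2, pr2 ∘ pr1⟩ S')))
       (pf_holds (leq A)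
          (pf_pair (pf_total (pr1 ∘ pr1))
             (papp (papp (pf_total (pr1 ∘ pr2)) (pf_total (pr1 ∘ pr2 ∘ pr2)))
                (pf_total (pr2 ∘ pr2 ∘ pr2)))))).

Lemma mem_meet_pred (X T : H) (S S' : Sub (prd A X)) (c : Hom T A) (x : Hom T X) :
  ⟨c, x⟩ ∈ meet_pred S S' <->
  exists T' (e : Hom T' T) (p a b q s : Hom T' A),
    is_regular_epi e /\ p ∈ realizers pair_comb /\
    ⟨a, x ∘ e⟩ ∈ S /\ ⟨b, x ∘ e⟩ ∈ S' /\
    pf_at (app A) ⟨p, a⟩ q /\ pf_at (app A) ⟨q, b⟩ s /\ ⟨c ∘ e, s⟩ ∈ leq A.
Proof.
split.
- intros M; apply mem_ex in M; destruct M as [T' [e [z [He [M Ez]]]]].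
  rewrite comp_pair in Ez; apply mem_meet in M; destruct M as [M M4].
  apply mem_meet in M; destruct M as [M1 M].
  apply mem_meet in M; destruct M as [M2 M3].
  apply mem_pb in M1; apply mem_pb in M2; apply mem_pb in M3.
  rewrite comp_pair, <- (comp_assoc pr2 pr1), Ez, pr2_pair in M2, M3.
  apply mem_holds in M4; destruct M4 as [y [Hy L]].
  rewrite <- (pair_eta y) in Hy, L; apply pf_at_ppair in Hy; destruct Hy as [H1 H2].
  apply pf_at_total in H1; rewrite <- comp_assoc, Ez, pr1_pair in H1.
  apply pf_at_papp in H2; destruct H2 as [q [b [Hq [Hb Hs]]]].
  apply pf_at_papp in Hq; destruct Hq as [p [a [Hp [Ha Hq]]]].
  apply pf_at_total in Hb; apply pf_at_total in Hp; apply pf_at_total in Ha.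
  subst p a b; rewrite <- H1 in L.
  exists T', e, (pr1 ∘ pr2 ∘ z), (pr1 ∘ pr2 ∘ pr2 ∘ z), (pr2 ∘ pr2 ∘ pr2 ∘ z), q, (pr2 ∘ y).
  tauto.
- intros [T' [e [p [a [b [q [s [He [Mp [Ma [Mb [Hq [Hs L]]]]]]]]]]]]].
  apply (mem_exI (x := ⟨⟨c ∘ e, x ∘ e⟩, ⟨p, ⟨a, b⟩⟩⟩) He);
    [|now rewrite pr1_pair, comp_pair].
  apply mem_meet; split; [apply mem_meet; split; [|apply mem_meet; split]|].
  + apply mem_pb; now project.
  + apply mem_pb; now project.
  + apply mem_pb; now project.
  + apply mem_holds; exists ⟨c ∘ e, s⟩; split; [|exact L].
    apply pf_at_ppair; split.
    * apply pf_at_total; now rewrite <- comp_assoc, !pr1_pair.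
    * apply pf_at_papp; exists q, b; split; [|split; [|exact Hs]].
      -- apply pf_at_papp; exists p, a; split; [|split; [|exact Hq]]; apply pf_at_total;
           now project.
      -- apply pf_at_total; now project.
Qed.

Definition dmeet (X : H) (S S' : Sub (prd A X)) : DOb A.
Proof.
refine {| dbase := X; dpred := meet_pred S S' |}.
abstract (intros T c d x L M; apply mem_meet_pred in M;
  destruct M as [T' [e [p [a [b [q [s [He [Mp [Ma [Mb [Hq [Hs Ls]]]]]]]]]]]]];
  apply mem_meet_pred; exists T', e, p, a, b, q, s; repeat split; try assumption;
  apply (mem_comp e) in L; rewrite comp_pair in L; exact (leq_trans L Ls)).
Defined.

(** * Realizers for maps out of and into binary meets *)

Section Realizers.
Context (phi : ExternalFilter A) (phi_complete : ext_complete phi).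

(* (x, y) |-> y x *)
Definition eval_comb : PFun (pow A 2) A :=
  papp (pf_total (pr2 : Hom (pow A 2) A)) (pf_total (pr2 ∘ pr1 : Hom (pow A 2) A)).

Lemma pcomb_eval : pcomb eval_comb.
Proof. apply pcomb_app; apply pcomb_proj; repeat constructor. Qed.

(** For [k] realizing [G] and [c] below a Church pair [p a b], the value [c k] lies below [p a b k],
    hence below [k a b], hence below [G (a, b)]. The realizer is thus [eval_comb] applied to [k]. *)
Lemma realizable_from_meet (X : H) (S S' : Sub (prd A X)) R (f : Hom X (dbase R))
    (G : PFun (pow A 2) A) :
  pcomb G ->
  (forall T (a b : Hom T A) (x : Hom T X), ⟨a, x⟩ ∈ S -> ⟨b, x⟩ ∈ S' ->
    exists v, pf_at G ⟨⟨bang T, a⟩, b⟩ v /\ ⟨v, f ∘ x⟩ ∈ dpred R) ->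
  realizable phi (P := dmeet S S') (Q := R) f.
Proof.
intros HG K; apply realizable_sat.
apply (@sat_app phi (realizers G)); [apply local_realizes|now apply phi_complete|].
exists (realizers eval_comb); split; [apply phi_complete, pcomb_eval|].
intros T u Mu; apply (part_imp (m := 0) (part_zero Mu)).
intros T1 t1 k w1 Mk Pw1; apply (part_realizes (P := dmeet S S') Pw1).
intros T2 t2 c x Mc; apply mem_meet_pred in Mc.
destruct Mc as [T' [e [p [a [b [q [s [He [Mp [Ma [Mb [Hq [Hs L]]]]]]]]]]]]].
destruct (K _ _ _ _ Ma Mb) as [v [Hv Mv]].
apply (mem_comp t2), (mem_comp e) in Mk.
destruct (part_step (m := 0) (f := G) a (part_zero Mk)) as [g [Hg Pg]].
destruct (part_last Pg Hv) as [d [Hd Ld]].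
destruct (part_step (m := 1) (f := pair_comb) a (part_zero Mp)) as [q' [Hq' Pq]].
rewrite <- (pf_at_fun Hq Hq') in Pq.
destruct (part_step (m := 0) (f := pair_comb) b Pq) as [s' [Hs' Ps]].
rewrite <- (pf_at_fun Hs Hs') in Ps.
destruct (part_last Ps (pair_comb_at (bang _) Hg Hd)) as [z [Hz Lz]].
destruct (app_mono L (leq_refl _) Hz) as [z' [Hz' Lz']].
exists T', e, z'; split; [exact He|split].
- apply pf_at_papp; exists (c ∘ e), (k ∘ t2 ∘ e); split; [|split; [|exact Hz']];
    apply pf_at_total; now project.
- apply (ddown (leq_trans Lz' (leq_trans Lz Ld))); now rewrite <- comp_assoc.
Qed.

(* (p, y, z, c) |-> p (y c) (z c) *)
Definition tuple_comb : PFun (pow A 4) A :=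
  papp
    (papp (pf_total (pr2 ∘ pr1 ∘ pr1 ∘ pr1 : Hom (pow A 4) A))
       (papp (pf_total (pr2 ∘ pr1 ∘ pr1 : Hom (pow A 4) A)) (pf_total (pr2 : Hom (pow A 4) A))))
    (papp (pf_total (pr2 ∘ pr1 : Hom (pow A 4) A)) (pf_total (pr2 : Hom (pow A 4) A))).

Lemma pcomb_tuple : pcomb tuple_comb.
Proof. repeat apply pcomb_app; apply pcomb_proj; repeat constructor. Qed.

Lemma tuple_comb_at (T : H) (z : Hom T (pow A 0)) (p u v c a b q s : Hom T A) :
  pf_at (app A) ⟨u, c⟩ a -> pf_at (app A) ⟨v, c⟩ b ->
  pf_at (app A) ⟨p, a⟩ q -> pf_at (app A) ⟨q, b⟩ s ->
  pf_at tuple_comb ⟨⟨⟨⟨z, p⟩, u⟩, v⟩, c⟩ s.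
Proof.
intros Ha Hb Hq Hs.
apply pf_at_papp; exists q, b; split; [|split; [|exact Hs]]; apply pf_at_papp.
- exists p, a; split; [|split; [|exact Hq]].
  + apply pf_at_total; now project.
  + apply pf_at_papp; exists u, c; split; [|split; [|exact Ha]]; apply pf_at_total; now project.
- exists v, c; split; [|split; [|exact Hb]]; apply pf_at_total; now project.
Qed.

(** If [u] and [v] realize the two maps, then [p (u c) (v c)] realizes the map into the meet. The
    pairing realizer [p] is an argument of [tuple_comb] because it must serve as the witness in
    [meet_pred]. *)
Lemma realizable_pair R (X : H) (f : Hom (dbase R) X) (S S' : Sub (prd A X)) dS dS' :
  realizable phi (P := R) (Q := @Build_DOb H A X S dS) f ->
  realizable phi (P := R) (Q := @Build_DOb H A X S' dS') f ->
  realizable phi (P := R) (Q := dmeet S S') f.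
Proof.
intros [U [HU RU]] [V [HV RV]]; apply realizable_sat.
(* The arguments are supplied from the last to the first, so that [tuple_comb] receives [p], [u],
   [v] in this order. *)
apply (@sat_app phi V); [apply local_realizes|exact HV|].
apply (@sat_app phi U); [apply local_imp, local_realizes|exact HU|].
apply (@sat_app phi (realizers pair_comb));
  [apply local_imp, local_imp, local_realizes|apply phi_complete, pcomb_pair|].
exists (realizers tuple_comb); split; [apply phi_complete, pcomb_tuple|].
intros T r Mr; apply (part_imp (m := 2) (part_zero Mr)).
intros T1 t1 p w1 Mp Pw1; apply (part_imp (m := 1) Pw1).
intros T2 t2 u w2 Mu Pw2; apply (part_imp (m := 0) Pw2).
intros T3 t3 v w3 Mv Pw3; apply (part_realizes (Q := dmeet S S') Pw3).
intros T4 t4 c x Mc.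
apply (mem_comp t4) in Mv; apply (mem_comp t3), (mem_comp t4) in Mu.
apply (mem_comp t2), (mem_comp t3), (mem_comp t4) in Mp.
destruct (RU _ _ _ _ Mu Mc) as [a [Ha Ma]].
destruct (RV _ _ _ _ Mv Mc) as [b [Hb Mb]].
destruct (part_step (m := 1) (f := pair_comb) a (part_zero Mp)) as [q [Hq Pq]].
destruct (part_step (m := 0) (f := pair_comb) b Pq) as [s [Hs _]].
exists T4, (idm _), s; split; [apply regular_epi_id|split].
- rewrite comp_idr; cbn [pow Nat.add]; rewrite !comp_pair; now apply (tuple_comb_at _ Ha Hb Hq).
- apply mem_meet_pred; exists T4, (idm _), (p ∘ t2 ∘ t3 ∘ t4), a, b, q, s.
  rewrite !comp_idr; repeat split; try assumption; [apply regular_epi_id|apply leq_refl].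
Qed.

End Realizers.
End Internal.

(** * The realizability fibration is a fibred model *)

Section Realizability.
Context (H : HeytingCategory) (A : OPAS H) (phi : ExternalFilter A).
Context (phi_complete : ext_complete phi).

Let D := DFib phi_complete.

Lemma dfib_faithful (P Q : DCat phi_complete) (g h : Hom P Q) :
  fmap D g = fmap D h -> g = h.
Proof. apply DHom_eq. Qed.

Lemma ov_realizable (P Q : DCat phi_complete) (f : Hom (dbase P) (dbase Q)) :
  ov D f P Q <-> realizable phi f.
Proof.
split.
- intros O; destruct (ov_arr O) as [g <-]; exact (proj2_sig g).
- intros K; exact (ov_fmap D (exist _ f K : @Hom (DCat phi_complete) P Q)).
Qed.

Lemma dreindex_reindex (X : H) (Q : DCat phi_complete) (f : Hom X (dbase Q)) :
  reindex D f Q (dreindex f).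
Proof.
apply (reindexI dfib_faithful).
- apply (@ov_realizable (dreindex f) Q), realizable_incl; [exact phi_complete|].
  intros T a x; apply mem_reindex_pred.
- intros R X' k O; pose proof (ov_dom O); subst X'.
  apply (@ov_realizable R Q) in O; destruct O as [U [HU K]].
  apply (@ov_realizable R (dreindex f)); exists U; split; [exact HU|].
  intros T u a x Mu Ma; destruct (K _ _ _ _ Mu Ma) as [w [Hw Mw]].
  exists w; split; [exact Hw|]; apply mem_reindex_pred; now rewrite comp_assoc.
Qed.

Lemma dexists_coindex (P : DCat phi_complete) (Y : H) (f : Hom (dbase P) Y) :
  coindex D f P (dexists f).
Proof.
apply (coindexI dfib_faithful).
- apply (@ov_realizable P (dexists f)), realizable_incl; [exact phi_complete|].
  intros T a x Ma; apply mem_ex_pred; exists T, (idm T), x.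
  rewrite !comp_idr; split; [apply regular_epi_id|now split].
- intros R Y' k O; pose proof (ov_cod O); subst Y'.
  apply (@ov_realizable P R) in O; destruct O as [U [HU K]].
  apply (@ov_realizable (dexists f) R); exists U; split; [exact HU|].
  intros T u a y Mu Ma; cbn [dbase dexists] in *; apply mem_ex_pred in Ma.
  destruct Ma as [T' [e [x [He [Ma Ex]]]]].
  destruct (K _ _ _ _ (mem_comp e Mu) Ma) as [w [Hw Mw]].
  rewrite <- comp_pair in Hw; destruct (pf_at_local He Hw) as [w0 [Hw0 <-]].
  exists w0; split; [exact Hw0|]; apply (mem_local He).
  now rewrite comp_pair, <- comp_assoc, <- Ex, comp_assoc.
Qed.

Lemma dtop_top (X : H) : is_top D X (dtop A X).
Proof.
split; [reflexivity|]; intros P EP; subst X.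
apply (@ov_fib_le _ _ _ _ _ (dbase P)), (@ov_realizable P (dtop A (dbase P))).
apply realizable_incl; [exact phi_complete|]; intros; apply mem_full.
Qed.

Lemma dmeet_meet (X : H) (S S' : Sub (prd A X)) dS dS' :
  is_meet D (@Build_DOb H A X S dS) (@Build_DOb H A X S' dS') (dmeet S S').
Proof.
apply (@is_meetI _ _ _ X).
- apply (@ov_realizable (dmeet S S') (@Build_DOb H A X S dS)).
  apply (realizable_from_meet phi_complete (G := pf_total (pr2 ∘ pr1 : Hom (pow A 2) A))).
  + apply pcomb_proj; repeat constructor.
  + intros T a b x Ma _; rewrite comp_idl; exists a; split; [|exact Ma].
    apply pf_at_total; now project.
- apply (@ov_realizable (dmeet S S') (@Build_DOb H A X S' dS')).
  apply (realizable_from_meet phi_complete (G := pf_total (pr2 : Hom (pow A 2) A))).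
  + apply pcomb_proj; repeat constructor.
  + intros T a b x _ Mb; rewrite comp_idl; exists b; split; [|exact Mb].
    apply pf_at_total; now project.
- intros R O O'; pose proof (ov_dom O); subst X.
  apply (@ov_realizable R (@Build_DOb H A (dbase R) S dS)) in O.
  apply (@ov_realizable R (@Build_DOb H A (dbase R) S' dS')) in O'.
  apply (@ov_realizable R (dmeet S S')).
  exact (realizable_pair phi_complete O O').
Qed.

Lemma dfib_beck_chevalley (W X Y Z : H) (a : Hom W X) (b : Hom W Y)
    (f : Hom X Z) (g : Hom Y Z) P P' Q Q' R :
  is_pullback a b f g ->
  coindex D f P Q -> reindex D g Q Q' -> reindex D a P P' -> coindex D b P' R ->
  fib_equiv D Q' R.
Proof.
intros [Eab U] C; pose proof (ov_dom (coindex_ov C)); subst X; revert C.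
pose (P1 := dreindex (Q := P) a : DCat phi_complete).
pose (Q1 := dexists (P := P) f : DCat phi_complete).
pose (R1 := dexists (P := P1) b : DCat phi_complete).
pose (Q1' := dreindex (Q := Q1) g : DCat phi_complete).
apply (@beck_chevalley_of_choice _ _ D dfib_faithful _ _ _ _ a b f g P P' Q Q' R P1 Q1 Q1' R1).
- exact Eab.
- exact (@dexists_coindex P Z f).
- exact (@dreindex_reindex Y Q1 g).
- exact (@dreindex_reindex W P a).
- exact (@dexists_coindex P1 Y b).
- apply (@ov_fib_le _ _ _ _ _ Y), (@ov_realizable Q1' R1), realizable_incl; [exact phi_complete|].
  intros T c y M; rewrite comp_idl; apply mem_reindex_pred, mem_ex_pred in M.
  destruct M as [T' [e [x [He [M Ex]]]]]; rewrite <- comp_assoc in Ex.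
  destruct (U _ _ _ Ex) as [t [[E1 E2] _]].
  apply mem_ex_pred; exists T', e, t; split; [exact He|split; [|exact E2]].
  apply mem_reindex_pred; exact (eq_ind_r (fun z => ⟨c ∘ e, z⟩ ∈ dpred P) M E1).
Qed.

Lemma dfib_frobenius (X Y : H) (f : Hom X Y) P Q Q' M N P' M' :
  reindex D f Q Q' -> is_meet D P Q' M -> coindex D f M N ->
  coindex D f P P' -> is_meet D P' Q M' -> fib_equiv D N M'.
Proof.
intros I HM C C'; pose proof (ov_dom (coindex_ov C')) as EX.
pose proof (ov_cod (reindex_ov I)) as EY; revert I HM C C'.
destruct P as [X0 S dS], Q as [Y0 S' dS']; cbn in EX, EY; subst X0 Y0.
set (P := @Build_DOb H A X S dS : DCat phi_complete).
set (Q := @Build_DOb H A Y S' dS' : DCat phi_complete).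
pose (Q1 := dreindex (Q := Q) f : DCat phi_complete).
pose (M1 := dmeet S (reindex_pred f S') : DCat phi_complete).
pose (N1 := dexists (P := M1) f : DCat phi_complete).
pose (P1 := dexists (P := P) f : DCat phi_complete).
pose (M1' := dmeet (ex_pred f S) S' : DCat phi_complete).
apply (@frobenius_of_choice _ _ D dfib_faithful _ _ f P Q Q' M N P' M' Q1 M1 N1 P1 M1').
- exact (@dreindex_reindex X Q f).
- exact (@dmeet_meet X S (reindex_pred f S') dS _).
- exact (@dexists_coindex M1 Y f).
- exact (@dexists_coindex P Y f).
- exact (@dmeet_meet Y (ex_pred f S) S' _ dS').
(* The formulas for [M1'] and [N1] differ only in the order of existential quantifiers, so no
   realizer is changed. *)
- apply (@ov_fib_le _ _ _ _ _ Y), (@ov_realizable M1' N1), realizable_incl; [exact phi_complete|].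
  intros T c y K; rewrite comp_idl; apply mem_meet_pred in K.
  destruct K as [T' [e [p [a [b [q [s [He [Mp [Ma [Mb [Hq [Hs L]]]]]]]]]]]]].
  apply mem_ex_pred in Ma; destruct Ma as [T'' [e' [x [He' [Ma Ex]]]]].
  apply (mem_local He); rewrite comp_pair; apply mem_ex_pred.
  exists T'', e', x; split; [exact He'|split; [|exact Ex]].
  apply mem_meet_pred; exists T'', (idm _), (p ∘ e'), (a ∘ e'), (b ∘ e'), (q ∘ e'), (s ∘ e').
  apply (mem_comp e') in Mb, L; apply (pf_at_comp e') in Hq, Hs.
  rewrite comp_pair in Mb, L, Hq, Hs; rewrite !comp_idr.
  repeat split; try assumption; [apply regular_epi_id|now apply mem_comp|].
  apply mem_reindex_pred; now rewrite Ex.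
Qed.

Lemma dfib_supine_lift (X Y : H) (f : Hom X Y) (P : DCat phi_complete) :
  D P = X -> exists Q, coindex D f P Q.
Proof. intros EX; subst X; exists (dexists (P := P) f); apply dexists_coindex. Qed.

Lemma dfib_locale : fibred_locale D.
Proof.
split.
- exact dfib_faithful.
- intros X Q f; exists (dreindex (Q := Q) f); apply dreindex_reindex.
- intros Y P f; exists (dexists (P := P) f); apply dexists_coindex.
- intros X; exists (dtop A X); apply dtop_top.
- intros [X S dS] [X' S' dS'] EX; cbn in EX; subst X'.
  exists (dmeet S S'); apply dmeet_meet.
- exact (reindex_top_of_coindex dfib_faithful dfib_supine_lift).
- exact (reindex_meet_of_coindex dfib_faithful dfib_supine_lift).
- exact dfib_beck_chevalley.
- exact dfib_frobenius.
Qed.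

Lemma dfib_separated : separated D.
Proof.
intros X Y e T T' He HT C; split; [exact (ov_cod (coindex_ov C))|].
pose (E := dexists (P := dtop A X) e : DCat phi_complete).
intros P EP; apply (fib_le_trans (proj2 (dtop_top Y) P EP)).
apply (fib_le_trans (Q := E)).
- apply (@ov_fib_le _ _ _ _ _ Y), (@ov_realizable (dtop A Y) E), realizable_incl;
    [exact phi_complete|].
  intros Z a y _; rewrite comp_idl.
  destruct (regular_epi_pb y He) as [Z' [e' [x [He' Ex]]]].
  apply mem_ex_pred; exists Z', e', x; split; [exact He'|split; [apply mem_full|exact Ex]].
- apply (coindex_le dfib_faithful (@dexists_coindex (dtop A X) Y e)).
  exact (ov_le_l (proj2 HT (dtop A X) eq_refl) (coindex_ov C)).
Qed.

(** Evaluated on the components of a Church pair, it realizes the closure of [ring_filter] under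
    application. *)
Definition app_comb : PFun (pow A 2) A :=
  papp (pf_total (pr2 ∘ pr1 : Hom (pow A 2) A)) (pf_total (pr2 : Hom (pow A 2) A)).

Lemma ring_vertical_filter : vertical_filter D A (ring_filter phi_complete).
Proof.
set (C := ring_filter phi_complete).
split; [reflexivity| |].
- intros P Q I J; apply (reindex_le dfib_faithful J).
  pose (f := pr1 ∘ sarr (leq A)).
  pose (g := pr2 ∘ sarr (leq A) : Hom (sdom (leq A)) (dbase C)).
  pose (P1 := dreindex (Q := C) f : DCat phi_complete).
  apply (@ov_le_l _ _ _ _ _ _ _ P1).
  + exact (reindex_le dfib_faithful (@dreindex_reindex _ C f) (reindex_ov I)).
  + apply (@ov_realizable P1 C g), realizable_incl; [exact phi_complete|].
    intros T a x Ma; apply mem_reindex_pred in Ma; apply (leq_trans Ma).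
    unfold f, g; rewrite <- !comp_assoc, pair_eta; now exists x.
- intros P Q M R I J [L1 [L2 _]] K; apply (reindex_le dfib_faithful K).
  pose (f := pr1 ∘ sarr (pdom (app A))).
  pose (g := pr2 ∘ sarr (pdom (app A))).
  pose (M1 := dmeet (reindex_pred f (leq A)) (reindex_pred g (leq A)) : DCat phi_complete).
  apply (@ov_le_l _ _ _ _ _ _ _ M1).
  + destruct (@dmeet_meet _ (reindex_pred f (leq A)) (reindex_pred g (leq A))
      (ddown (d := dreindex (Q := C) f)) (ddown (d := dreindex (Q := C) g))) as [_ [_ U]].
    apply U.
    * apply (fib_le_trans L1).
      exact (reindex_le dfib_faithful (@dreindex_reindex _ C f) (reindex_ov I)).
    * apply (fib_le_trans L2).
      exact (reindex_le dfib_faithful (@dreindex_reindex _ C g) (reindex_ov J)).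
  + apply (@ov_realizable M1 C), (realizable_from_meet phi_complete (G := app_comb)).
    { apply pcomb_app; apply pcomb_proj; repeat constructor. }
    intros T a b x Ma Mb; apply mem_reindex_pred in Ma; apply mem_reindex_pred in Mb.
    assert (Hx : pf_at (app A) ⟨f ∘ x, g ∘ x⟩ (pval (app A) ∘ x)).
    { exists x; split; [|reflexivity].
      unfold f, g; now rewrite <- !comp_assoc, pair_eta. }
    destruct (app_mono Ma Mb Hx) as [v [Hv L]].
    exists v; split; [|exact L].
    apply pf_at_papp; exists a, b; split; [|split; [|exact Hv]];
      apply pf_at_total; now project.
Qed.

(** A terminal object of the total category is isomorphic to [dtop A one], so the identity of its
    base factors through [one]. *)
Lemma dfib_terminal_unique (T : DCat phi_complete) (Z : H) (x y : Hom Z (dbase T)) :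
  is_terminal T -> x = y.
Proof.
intros HT; destruct (HT (dtop A one)) as [i _].
assert (J : realizable phi (P := T) (Q := dtop A one) (bang (dbase T))).
{ apply realizable_incl; [exact phi_complete|]; intros; apply mem_full. }
pose (j := exist _ _ J : @Hom (DCat phi_complete) T (dtop A one)).
destruct (HT T) as [t [_ Ut]].
assert (E : i ∘ j = idm T) by (rewrite <- (Ut (i ∘ j)), <- (Ut (idm T)); trivial).
apply (f_equal (fmap D)) in E; cbn in E.
rewrite <- (comp_idl x), <- (comp_idl y), <- E, <- !comp_assoc.
now rewrite (bang_uniq (bang _ ∘ x)), (bang_uniq (bang _ ∘ y)).
Qed.

(** Each [u] in [U] realizes its own point of [P1], so applying a realizer of the given arrow to it
    yields an element of [R] over the image of that point. All points of a terminal object agree,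
    hence these values lie in [R] over every point; the combinator [(y, a) |-> y] makes them
    constant realizers of the arrow out of [T]. *)
Lemma dfib_filter_supine (U : Sub A) :
  phi U -> forall (P T : DCat phi_complete) (g : Hom P T),
  reindex D (sarr U) (ring_filter phi_complete) P -> is_terminal T -> is_supine D g.
Proof.
intros HU P T g I HT; apply (supine_ov dfib_faithful); intros R k O.
pose (C := ring_filter phi_complete).
pose (P1 := dreindex (Q := C) (sarr U) : DCat phi_complete).
assert (L : fib_le D P1 P).
{ apply (reindex_le dfib_faithful I), reindex_ov, dreindex_reindex. }
destruct L as [l _].
assert (O' : ov D (k ∘ fmap D g ∘ fmap D l) P1 R) by exact (ov_comp O (ov_fmap D l)).
apply (@ov_realizable P1 R) in O'; destruct O' as [V [HV RV]].
pose (Φ := fun (Z : H) (q : Hom Z A) => forall Z' (t : Hom Z' Z) (x : Hom Z' (dbase T)),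
  ⟨q ∘ t, k ∘ x⟩ ∈ dpred R).
assert (HΦ : local_pred Φ).
{ split.
  - intros Z Z' u t K Z'' s x; rewrite <- comp_assoc; apply K.
  - intros Z u u' L K Z' t x; apply (mem_comp t) in L; rewrite comp_pair in L.
    exact (ddown (d := R) L (K _ t x)).
  - intros Z Z0 u e He K Z' t x.
    destruct (regular_epi_pb t He) as [Z'' [e' [s [He' Es]]]].
    apply (mem_local He'); rewrite comp_pair, <- !comp_assoc, <- Es, comp_assoc; apply K. }
assert (S : sat phi Φ).
{ apply (sat_app HΦ HU); exists V; split; [exact HV|].
  intros Z v Mv Z' t u [z Ez].
  destruct (RV _ (v ∘ t) u z) as [w [Hw Mw]].
  { now apply mem_comp. }
  { apply mem_reindex_pred; exact (eq_ind_r (fun y => ⟨u, y⟩ ∈ leq A) (leq_refl u) Ez). }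
  exists w; split; [exact Hw|]; intros Z'' s x.
  apply (mem_comp s) in Mw; rewrite comp_pair, <- !comp_assoc in Mw.
  now rewrite (dfib_terminal_unique x (fmap D g ∘ (fmap D l ∘ (z ∘ s))) HT). }
destruct S as [W [HW RW]].
pose (G := pf_total (pr2 ∘ pr1 : Hom (pow A 2) A)).
apply (@ov_realizable T R), realizable_sat.
apply (sat_app (local_realizes _) HW); exists (realizers G); split.
{ apply phi_complete, pcomb_proj; repeat constructor. }
intros Z r Mr; apply (part_imp (m := 0) (part_zero Mr)).
intros Z1 t1 y w My Pw; apply (part_realizes Pw).
intros Z2 t2 a x Ma; exists Z2, (idm _), (y ∘ t2); split; [apply regular_epi_id|split].
- rewrite comp_idr; apply pf_at_total; now project.
- rewrite comp_idr; exact (RW _ _ My _ t2 x).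
Qed.

Lemma dfib_model : is_fibred_model phi D (ring_filter phi_complete).
Proof.
split.
- exact dfib_locale.
- exact dfib_separated.
- exact ring_vertical_filter.
- exact dfib_filter_supine.
Qed.

End Realizability.

(** * The interpretation in a fibred model *)

Section Interpretation.
Context (H : HeytingCategory) (A : OPAS H) (phi : ExternalFilter A).
Context (phi_complete : ext_complete phi).
Context (E : Category) (F : Functor E H) (C : E) (FM : is_fibred_model phi F C).

Let FL := fm_locale FM.
Let faithful := fl_faithful FL.

Lemma prd_pullback (X Y : H) : is_pullback (pr1 : Hom (prd X Y) X) pr2 (bang X) (bang Y).
Proof.
split.
- now rewrite (bang_uniq (bang X ∘ pr1)), (bang_uniq (bang Y ∘ pr2)).
- intros T x y _; exists ⟨x, y⟩; split; [split; [apply pr1_pair|apply pr2_pair]|].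
  intros t [<- <-]; apply pair_eta.
Qed.

(* As in Kripke-Joyal semantics, a supine arrow [R' -> R] over [e] serves as a cover
   of [R]: to map out of [R] it suffices to map out of [R']. *)
Lemma cover_filter (U : Sub A) (Z : H) (R : E) : phi U -> F R = Z ->
  exists Z' (e : Hom Z' Z) R' (u : Hom Z' A),
    coindex F e R' R /\ ov F u R' C /\ u ∈ U.
Proof.
intros HU ER.
destruct (prone_lift FL (sarr U) (vf_over (fm_filter FM))) as [PU IU].
destruct (fl_top FL one) as [T HT].
destruct (top_ov FL (bang (sdom U)) HT (ov_dom (reindex_ov IU))) as [g Eg].
pose proof (fm_supine FM HU (g := g) IU (terminal_top FL HT)) as Sg.
assert (CU : coindex F (bang (sdom U)) PU T) by now exists g.
destruct (prone_lift FL (pr1 : Hom (prd (sdom U) Z) _) (ov_dom (reindex_ov IU))) as [P' I'].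
destruct (supine_lift FL (pr2 : Hom (prd (sdom U) Z) Z) (ov_dom (reindex_ov I'))) as [Q CQ].
destruct (prone_lift FL (bang Z) (proj1 HT)) as [T' IT].
(* The supine arrow from [C] restricted to [U] is moved from [one] to [Z]: the top [T'] over [Z],
   and with it [R], lies below the coindexing of [P'] along the second projection. *)
destruct (fl_beck_chevalley FL (prd_pullback (sdom U) Z) CU IT I' CQ) as [L _].
assert (LR : fib_le F R Q).
{ refine (fib_le_trans _ L); now apply (fl_reindex_top FL HT IT). }
destruct (cover_of_le FL CQ LR) as [R' [C' L']].
exists (prd (sdom U) Z), pr2, R', (sarr U ∘ pr1); split; [exact C'|split].
- apply (ov_comp (reindex_ov IU)); exact (ov_le_l L' (reindex_ov I')).
- now exists pr1.
Qed.

(** Separatedness makes the top over [Y] a coindexing of the top over [X], and [cover_of_le] cuts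
    this cover down to [R]. It lets the regular epimorphisms that come with internal existential
    quantifiers act as covers in [F]. *)
Lemma cover_regular_epi (X Y : H) (e : Hom X Y) (R : E) : is_regular_epi e -> F R = Y ->
  exists R', coindex F e R' R.
Proof.
intros He ER; destruct (fl_top FL X) as [T HT].
destruct (supine_lift FL e (proj1 HT)) as [T' CT].
pose proof (fm_separated FM He HT CT) as HT'.
destruct (cover_of_le FL CT (proj2 HT' R ER)) as [R' [C' _]]; now exists R'.
Qed.

(** Reading [ov F x R C] as: [R] forces that [x] belongs to [C], this and [filter_app] are the
    closure conditions on [C] for generalized elements. *)
Lemma filter_leq (Z : H) (R : E) (x y : Hom Z A) :
  ov F x R C -> ⟨x, y⟩ ∈ leq A -> ov F y R C.
Proof.
intros O [t Et]; pose proof (vf_over (fm_filter FM)) as EC.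
destruct (prone_lift FL (pr1 ∘ sarr (leq A)) EC) as [P I].
destruct (prone_lift FL (pr2 ∘ sarr (leq A)) EC) as [Q J].
rewrite <- (pr1_pair x y), <- Et, comp_assoc in O.
apply (reindex_lift faithful I) in O.
apply (ov_le_r (Q := P) (R := Q)) in O; [|exact (vf_leq (fm_filter FM) I J)].
rewrite <- (pr2_pair x y), <- Et, comp_assoc; exact (ov_comp (reindex_ov J) O).
Qed.

Lemma filter_app (Z : H) (R : E) (x y v : Hom Z A) :
  ov F x R C -> ov F y R C -> pf_at (app A) ⟨x, y⟩ v -> ov F v R C.
Proof.
intros Ox Oy [t [Et <-]]; pose proof (vf_over (fm_filter FM)) as EC.
destruct (prone_lift FL (pr1 ∘ sarr (pdom (app A))) EC) as [P I].
destruct (prone_lift FL (pr2 ∘ sarr (pdom (app A))) EC) as [Q J].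
destruct (prone_lift FL (pval (app A)) EC) as [S K].
destruct (fl_meet FL (P := P) (Q := Q)) as [M HM].
{ rewrite (ov_dom (reindex_ov I)); symmetry; exact (ov_dom (reindex_ov J)). }
rewrite <- (pr1_pair x y), <- Et, comp_assoc in Ox.
rewrite <- (pr2_pair x y), <- Et, comp_assoc in Oy.
apply (reindex_lift faithful I) in Ox; apply (reindex_lift faithful J) in Oy.
apply (ov_comp (reindex_ov K)).
exact (ov_le_r (meet_ov FL HM Ox Oy) (vf_app (fm_filter FM) I J HM K)).
Qed.

Lemma interp_exists (P : DOb A) :
  exists Q W, reindex F (pr1 ∘ sarr (dpred P)) C W /\ coindex F (pr2 ∘ sarr (dpred P)) W Q.
Proof.
destruct (prone_lift FL (pr1 ∘ sarr (dpred P)) (vf_over (fm_filter FM))) as [W I].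
destruct (supine_lift FL (pr2 ∘ sarr (dpred P)) (ov_dom (reindex_ov I))) as [Q K].
now exists Q, W.
Qed.

(** A fibred locale only asserts that coindexing exists, so an object is picked by description. Only
    [interp_over], [interp_intro] and [interp_elim] look inside; the last two are the forcing
    clauses for: some [a] in [C] has [(a, x)] in [P]. *)
Definition interp (P : DOb A) : E :=
  proj1_sig (constructive_indefinite_description _ (interp_exists P)).

Lemma interp_over (P : DOb A) : F (interp P) = dbase P.
Proof.
unfold interp; destruct (constructive_indefinite_description _ _) as [Q [W [I K]]].
exact (ov_cod (coindex_ov K)).
Qed.

Lemma interp_intro (P : DOb A) (Z : H) (R : E) (a : Hom Z A) (x : Hom Z (dbase P)) :
  ov F a R C -> ⟨a, x⟩ ∈ dpred P -> ov F x R (interp P).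
Proof.
intros O [t Et].
unfold interp; destruct (constructive_indefinite_description _ _) as [Q [W [I K]]]; cbn.
rewrite <- (pr1_pair a x), <- Et, comp_assoc in O.
apply (reindex_lift faithful I) in O.
rewrite <- (pr2_pair a x), <- Et, comp_assoc; exact (ov_comp (coindex_ov K) O).
Qed.

Lemma interp_elim (P : DOb A) (Z : H) (R : E) (x : Hom Z (dbase P)) :
  ov F x R (interp P) ->
  exists Z' (e : Hom Z' Z) R' (a : Hom Z' A),
    coindex F e R' R /\ ov F a R' C /\ ⟨a, x ∘ e⟩ ∈ dpred P.
Proof.
unfold interp; destruct (constructive_indefinite_description _ _) as [Q [W [I K]]]; cbn.
intros O; pose (l := pr2 ∘ sarr (dpred P)).
destruct (prone_lift FL x (ov_cod O)) as [Q' J].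
destruct (prone_lift FL (pbk1 l x) (ov_dom (coindex_ov K))) as [W' IW].
destruct (supine_lift FL (pbk2 l x) (ov_dom (reindex_ov IW))) as [S CS].
(* Reindexing the coindexed object along [x] exhibits [R] below a coindexing over the pullback, from
   which [cover_of_le] extracts a cover. *)
destruct (fl_beck_chevalley FL (pbkP l x) K J IW CS) as [L _].
destruct (cover_of_le FL CS (fib_le_trans (reindex_le faithful J O) L)) as [R' [C' L']].
exists (pbk l x), (pbk2 l x), R', (pr1 ∘ sarr (dpred P) ∘ pbk1 l x).
split; [exact C'|split].
- apply (ov_comp (reindex_ov I)); exact (ov_le_l L' (reindex_ov IW)).
- exists (pbk1 l x); rewrite <- (proj1 (pbkP l x)); unfold l.
  now rewrite <- !comp_assoc, pair_eta.
Qed.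

Lemma interp_realizable (P Q : DOb A) (f : Hom (dbase P) (dbase Q)) :
  realizable phi f -> ov F f (interp P) (interp Q).
Proof.
intros [U [HU RU]].
destruct (interp_elim (ov_idm (interp_over P))) as [Z [e [R [a [Ce [Oa Ma]]]]]].
destruct (cover_filter HU (ov_dom Oa)) as [Z' [e' [R' [u [Ce' [Ou Mu]]]]]].
apply (mem_comp e') in Ma; rewrite comp_idl, comp_pair in Ma.
destruct (RU _ _ _ _ Mu Ma) as [v [Hv Mv]].
apply (coindex_desc faithful Ce), (coindex_desc faithful Ce'); rewrite <- comp_assoc.
refine (interp_intro (filter_app Ou (ov_comp Oa (coindex_ov Ce')) Hv) Mv).
Qed.

Lemma interp_arr_exists (P Q : DCat phi_complete) (g : Hom P Q) :
  exists h : Hom (interp P) (interp Q), arr_eq (fmap F h) (fmap (DFib phi_complete) g).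
Proof. exact (interp_realizable (proj2_sig g)). Qed.

Definition interp_arr (P Q : DCat phi_complete) (g : Hom P Q) : Hom (interp P) (interp Q) :=
  proj1_sig (constructive_indefinite_description _ (interp_arr_exists g)).

Lemma interp_arr_over (P Q : DCat phi_complete) (g : Hom P Q) :
  arr_eq (fmap F (interp_arr g)) (fmap (DFib phi_complete) g).
Proof. exact (proj2_sig (constructive_indefinite_description _ (interp_arr_exists g))). Qed.

Definition interp_functor : Functor (DCat phi_complete) E.
Proof.
refine {| fob := (fun P => interp P) : DCat phi_complete -> E; fmap := interp_arr |}.
- intros P; apply (faithful_arr_eq faithful (interp_arr_over (idm P))).
  rewrite !fmap_id, interp_over; constructor.
- intros P Q R g f; apply (faithful_arr_eq faithful (interp_arr_over (g ∘ f))).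
  rewrite !fmap_comp; apply arr_eq_comp; apply interp_arr_over.
Defined.

Lemma interp_le (P Q : DCat phi_complete) :
  fib_le (DFib phi_complete) P Q -> fib_le F (interp P) (interp Q).
Proof. intros [g [X G]]; exists (interp_arr g), X; exact (arr_eq_trans (interp_arr_over g) G). Qed.

Lemma interp_vertical : vertical_morphism (DFib phi_complete) F interp_functor.
Proof.
pose (D := DFib phi_complete).
pose proof (@dfib_faithful H A phi phi_complete) as DF.
split.
- exact interp_arr_over.
- intros P Q g Hg; apply (prone_reindex DF) in Hg.
  assert (I : reindex F (fmap D g) (interp Q) (interp P)).
  { apply (reindexI faithful); [exact (ex_intro _ _ (interp_arr_over g))|].
    intros R X k O; destruct (interp_elim O) as [Z [e [R' [a [Ce [Oa Ma]]]]]].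
    apply (coindex_desc faithful Ce).
    (* [P] is equivalent to the explicit reindexing [P1], whose membership relation is computable;
       [Q1] plays the same part for coindexing below. *)
    pose (P1 := dreindex (Q := Q) (fmap D g) : DCat phi_complete).
    apply (ov_le_r (Q := interp P1)).
    - apply (interp_intro (P := P1) Oa), mem_reindex_pred; now rewrite comp_assoc.
    - apply interp_le, (reindex_le DF Hg), reindex_ov.
      exact (@dreindex_reindex H A phi phi_complete _ Q (fmap D g)). }
  destruct I as [h [Hh Eh]]; cbn.
  now rewrite (faithful_arr_eq faithful (interp_arr_over g) Eh).
- intros P Q g Hg; apply (supine_coindex DF) in Hg.
  assert (I : coindex F (fmap D g) (interp P) (interp Q)).
  { apply (coindexI faithful); [exact (ex_intro _ _ (interp_arr_over g))|].
    intros R Y k O.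
    pose (Q1 := dexists (P := P) (fmap D g) : DCat phi_complete).
    apply (ov_le_l (Q := interp Q1)).
    { apply interp_le, (coindex_le DF Hg), coindex_ov.
      exact (@dexists_coindex H A phi phi_complete P _ (fmap D g)). }
    destruct (interp_elim (ov_idm (interp_over Q1))) as [Z [e [S [a [Ce [Oa Ma]]]]]].
    rewrite comp_idl in Ma; apply mem_ex_pred in Ma; destruct Ma as [Z' [e' [x [He [Ma Ex]]]]].
    (* The preimage [x] exists only after the regular epimorphism [e'], so [S] must be covered along
       it. *)
    destruct (cover_regular_epi He (ov_dom Oa)) as [S' Ce'].
    apply (coindex_desc faithful Ce), (coindex_desc faithful Ce'); rewrite <- comp_assoc.
    refine (eq_ind (fmap D g ∘ x) (fun z => ov F (k ∘ z) S' R) _ _ Ex).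
    rewrite comp_assoc; apply (ov_comp O).
    exact (interp_intro (ov_comp Oa (coindex_ov Ce')) Ma). }
  destruct I as [h [Hh Eh]]; cbn.
  now rewrite (faithful_arr_eq faithful (interp_arr_over g) Eh).
- intros X T [ET UT]; split; [rewrite <- ET; apply interp_over|].
  intros R ER; subst X.
  (* Any member of [phi] would do: it only supplies, locally, some element of [C], and the top
     predicate accepts every realizer. *)
  pose (U := realizers (pf_total (pr2 : Hom (pow A 1) A))).
  assert (HU : phi U) by apply phi_complete, pcomb_proj, proj_last.
  destruct (cover_filter HU ER) as [Z [e [R' [u [Ce [Ou _]]]]]].
  apply (coindex_le faithful Ce).
  pose (T1 := dtop A (D T) : DCat phi_complete).
  apply (ov_le_r (Q := interp T1)); [|now apply interp_le, UT].
  apply (interp_intro (P := T1) Ou), mem_full.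
- intros P Q M [M1 [M2 UM]]; split; [now apply interp_le|split; [now apply interp_le|]].
  intros R L1 L2.
  assert (EX : dbase P = dbase Q).
  { transitivity (dbase M); [symmetry; exact (fib_le_over M1)|exact (fib_le_over M2)]. }
  destruct P as [X S dS], Q as [X' S' dS']; cbn in EX; subst X'.
  pose (P := @Build_DOb H A X S dS : DCat phi_complete).
  pose (Q := @Build_DOb H A X S' dS' : DCat phi_complete).
  pose (N := dmeet S S' : DCat phi_complete).
  destruct (dmeet_meet phi_complete dS dS') as [N1 [N2 _]].
  apply (fib_le_trans (Q := interp N)); [|now apply interp_le, UM].
  assert (ER : F R = X) by exact (eq_trans (fib_le_over L1) (interp_over P)).
  pose proof (fib_le_ov ER L1) as O1; pose proof (fib_le_ov ER L2) as O2.
  destruct (interp_elim (P := P) O1) as [Z1 [e1 [R1 [a [C1 [Oa Ma]]]]]].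
  apply (coindex_ov) in C1 as OC1.
  destruct (interp_elim (P := Q) (ov_comp O2 OC1)) as [Z2 [e2 [R2 [b [C2 [Ob Mb]]]]]].
  (* Elements [a] and [b] of [C] witness the two predicates locally. A further cover puts a pairing
     realizer [p] into [C], and then [p a b] belongs to [C] as well. *)
  pose proof (phi_complete (pcomb_pair A)) as HU.
  destruct (cover_filter HU (ov_dom Ob)) as [Z3 [e3 [R3 [p [C3 [Op Mp]]]]]].
  apply (mem_comp e2), (mem_comp e3) in Ma; apply (mem_comp e3) in Mb.
  rewrite !comp_pair in Ma; rewrite comp_pair in Mb; rewrite !comp_idl in Ma, Mb.
  destruct (part_step (m := 1) (f := pair_comb A) (a ∘ e2 ∘ e3) (part_zero Mp)) as [q [Hq Pq]].
  destruct (part_step (m := 0) (f := pair_comb A) (b ∘ e3) Pq) as [s [Hs _]].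
  pose proof (ov_comp (ov_comp Oa (coindex_ov C2)) (coindex_ov C3)) as Oa'.
  pose proof (filter_app (filter_app Op Oa' Hq) (ov_comp Ob (coindex_ov C3)) Hs) as Os.
  apply (@ov_fib_le _ _ _ _ _ X), (coindex_desc faithful C1), (coindex_desc faithful C2),
    (coindex_desc faithful C3).
  rewrite comp_idl; apply (interp_intro (P := N) Os).
  apply mem_meet_pred; exists Z3, (idm _), p, (a ∘ e2 ∘ e3), (b ∘ e3), q, s.
  rewrite !comp_idr; repeat split; try assumption; [apply regular_epi_id|apply leq_refl].
Qed.

(** The interpretation says that some [a] in [C] lies below the given element: upward closure of [C]
    gives one direction, reflexivity of the order the other. *)
Lemma interp_ring : fib_equiv F (interp (ring_filter phi_complete)) C.
Proof.
pose (I := ring_filter phi_complete).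
pose proof (vf_over (fm_filter FM)) as EC; split.
- apply (@ov_fib_le _ _ _ _ _ (A : H)).
  destruct (interp_elim (ov_idm (interp_over I))) as [Z [e [R [a [Ce [Oa Ma]]]]]].
  apply (coindex_desc faithful Ce); exact (filter_leq Oa Ma).
- apply (@ov_fib_le _ _ _ _ _ (A : H)), (interp_intro (P := I) (ov_idm EC)), leq_refl.
Qed.

End Interpretation.

(** * Preservation by vertical morphisms and uniqueness of morphisms of models *)

Lemma vertical_morphism_ov (B : FinLim) (E E' : Category) (F : Functor E B)
    (F' : Functor E' B) (K : Functor E E') (X Y : B) (f : Hom X Y) P Q :
  vertical_morphism F F' K -> ov F f P Q -> ov F' f (K P) (K Q).
Proof. intros V [g G]; exists (fmap K g); exact (arr_eq_trans (vm_over V g) G). Qed.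

Lemma vertical_morphism_reindex (B : FinLim) (E E' : Category) (F : Functor E B)
    (F' : Functor E' B) (K : Functor E E') (X Y : B) (f : Hom X Y) P Q :
  vertical_morphism F F' K -> reindex F f Q P -> reindex F' f (K Q) (K P).
Proof.
intros V [g [Hg G]]; exists (fmap K g); split; [exact (vm_prone V Hg)|].
exact (arr_eq_trans (vm_over V g) G).
Qed.

Lemma vertical_morphism_coindex (B : FinLim) (E E' : Category) (F : Functor E B)
    (F' : Functor E' B) (K : Functor E E') (X Y : B) (f : Hom X Y) P Q :
  vertical_morphism F F' K -> coindex F f P Q -> coindex F' f (K P) (K Q).
Proof.
intros V [g [Hg G]]; exists (fmap K g); split; [exact (vm_supine V Hg)|].
exact (arr_eq_trans (vm_over V g) G).
Qed.

Lemma vertical_iso_inv (B : FinLim) (E : Category) (F : Functor E B) (P Q : E) (g : Hom P Q) :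
  is_vertical F g -> is_iso g -> fib_le F Q P.
Proof.
intros [X G] [h [Ehg _]]; exists h, X.
apply (f_equal (fmap F)) in Ehg; rewrite fmap_comp, fmap_id in Ehg.
revert G Ehg; generalize (fmap F g) (fmap F h).
intros g' h' G; destruct (arr_eq_ends G) as [E1 E2]; revert g' h' G.
rewrite E1, E2; intros g' h' G; rewrite (arr_eq_eq G), comp_idr; intros ->; constructor.
Qed.

Section Uniqueness.
Context (H : HeytingCategory) (A : OPAS H) (phi : ExternalFilter A).
Context (phi_complete : ext_complete phi).
Context (hM : is_fibred_model phi (DFib phi_complete) (ring_filter phi_complete)).

Let I := Build_FibredModel hM.

(** Downward closure of [P] gives the arrow from [W]; conversely each point of the predicate is its
    own witness, by reflexivity of the order. *)
Lemma dpred_decomposition (P : DCat phi_complete) :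
  exists W, reindex (DFib phi_complete) (pr1 ∘ sarr (dpred P)) (ring_filter phi_complete) W /\
    coindex (DFib phi_complete) (pr2 ∘ sarr (dpred P)) W P.
Proof.
pose (a := pr1 ∘ sarr (dpred P)); pose (x := pr2 ∘ sarr (dpred P)).
pose (C := ring_filter phi_complete).
pose (W := dreindex (Q := C) a : DCat phi_complete).
exists W; split; [exact (@dreindex_reindex _ _ _ phi_complete _ C a)|].
pose (Q := dexists (P := W) x : DCat phi_complete).
pose proof (@dfib_faithful H A phi phi_complete) as DF.
pose proof (@dexists_coindex _ _ _ phi_complete W _ x) as K.
apply (coindexI DF).
- apply (@ov_realizable _ _ _ phi_complete W P), realizable_incl; [exact phi_complete|].
  intros T b y Mb; apply mem_reindex_pred in Mb; apply (ddown Mb).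
  exists y; unfold a, x; now rewrite <- !comp_assoc, pair_eta.
- intros R Y k O; apply (@ov_le_l _ _ _ _ _ _ _ Q).
  + apply (@ov_fib_le _ _ _ _ _ (dbase P)), (@ov_realizable _ _ _ phi_complete P Q),
      realizable_incl; [exact phi_complete|].
    intros T b y [t Et]; rewrite comp_idl; apply mem_ex_pred; exists T, (idm T), t.
    rewrite !comp_idr; split; [apply regular_epi_id|split].
    * apply mem_reindex_pred; unfold a.
      rewrite <- comp_assoc, Et, pr1_pair; apply leq_refl.
    * unfold x; now rewrite <- comp_assoc, Et, pr2_pair.
  + exact (coindex_desc DF K O).
Qed.

Context (M : FibredModel phi).

(** The hypotheses are symmetric in [h] and [k], so exchanging them gives the reverse inequality,
    and in a faithful fibration the two make a vertical isomorphism. *)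
Lemma model_morphism_le (h k : ModelMorphism I M) (P : DCat phi_complete) :
  fib_le (fm_fun M) (mm_fun h P) (mm_fun k P).
Proof.
pose proof (fl_faithful (fm_locale (fm_ok M))) as faithful.
pose proof (mm_vertical h) as Vh; pose proof (mm_vertical k) as Vk.
destruct (dpred_decomposition P) as [W [R S]].
apply (coindex_le faithful (vertical_morphism_coindex Vh S)).
refine (ov_le_l _ (vertical_morphism_ov Vk (coindex_ov S))).
apply (reindex_le faithful (vertical_morphism_reindex Vk R)).
apply (ov_le_r (Q := mm_fun h (ring_filter phi_complete))).
- exact (vertical_morphism_ov Vh (reindex_ov R)).
- apply (fib_le_trans (Q := fm_obj M)).
  + exists (mm_arr h); exact (mm_arr_vertical h).
  + exact (vertical_iso_inv (mm_arr_vertical k) (mm_arr_iso k)).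
Qed.

End Uniqueness.

Theorem theorem2p3p4 (H : HeytingCategory) (A : OPCA H) (phi : ExternalFilter A)
    (phi_complete : ext_complete phi) :
  exists hM : is_fibred_model phi (DFib phi_complete) (ring_filter phi_complete),
    pseudoinitial (Build_FibredModel hM).
Proof.
exists (dfib_model phi_complete); intros M.
pose proof (fl_faithful (fm_locale (fm_ok M))) as faithful.
split.
- destruct (interp_ring phi_complete (fm_ok M)) as [[h Vh] L].
  exists; exact (@Build_ModelMorphism H A phi (Build_FibredModel (dfib_model phi_complete)) M
    (interp_functor phi_complete (fm_ok M)) (interp_vertical phi_complete (fm_ok M))
    h Vh (vertical_iso faithful Vh L)).
- intros h k.
  pose (arr P := constructive_indefinite_description _ (model_morphism_le h k P)).
  assert (V : forall P, is_vertical (fm_fun M) (proj1_sig (arr P))).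
  { intros P; exact (proj2_sig (arr P)). }
  exists; refine (@Build_Model2Morphism H A phi (Build_FibredModel (dfib_model phi_complete))
    M h k (fun P => proj1_sig (arr P)) _ _ _ _).
  (* Both composites lie over the base arrow of [g], because the components are vertical. *)
  + intros P Q g; apply (faithful_arr_eq faithful (f := fmap (DFib phi_complete) g)).
    * exact (vertical_comp_l (V Q) (vm_over (mm_vertical h) g)).
    * exact (vertical_comp_r (V P) (vm_over (mm_vertical k) g)).
  + exact V.
  + intros P; exact (vertical_iso faithful (V P) (model_morphism_le k h P)).
  + destruct (mm_arr_vertical h) as [X Eh].
    apply (faithful_arr_eq faithful (f := idm X)); [|exact Eh].
    apply (vertical_comp_l (mm_arr_vertical k)), (vertical_over (V _)).
    exact (proj1 (arr_eq_ends Eh)).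
Qed.
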